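(* Let $a,b,c,d$ be four positive integers and $n=a+b+c+d+3$. Let \begin{align*} X&=\binom{n-2}{a}\sum_{i=0}^{b-1}\sum_{j=0}^{d}(d-j+1)\binom{i+j+c-1}{i,\,j,\,c-1},\\ Z&=\binom{n-2}{d}\sum_{i=0}^{c-1}\sum_{j=0}^{a}(a-j+1)\binom{i+j+b-1}{i,\,j,\,b-1}, \end{align*} where $\binom{p+q+r}{p,\,q,\,r}=\frac{(p+q+r)!}{p!\,q!\,r!}$. Then the number of tangled labelings of the $W$-poset $W_{a,b,c,d}$ is $$(n-2)(n-2)!-a!\,b!\,c!\,d!\,(X+Z).$$
   Context: Let $P$ be a finite poset with $n$ elements. A labeling of $P$ is a bijection $L:P\to\{1,\dots,n\}$; it is natural if $x<_P y$ implies $L(x)<L(y)$. The (extended) promotion $\partial L$ of a labeling $L$ is obtained as follows: (1) repeat until the element labeled $1$ is maximal: let $u$ be the element labeled $1$ and let $v$ be the element with the smallest label among all elements $v>_P u$; swap the labels of $u$ and $v$; (2) then simultaneously replace the label $1$ by $n$ and each label $i>1$ by $i-1$. The order of $L$ is the smallest $k\ge 0$ such that $\partial^k L$ is natural (it is known that the order is always at most $n-1$). $L$ is tangled if its order equals $n-1$. The $W$-poset $W_{a,b,c,d}$ is the poset on $a+b+c+d+3$ elements $\alpha_1,\dots,\alpha_a,\beta_1,\dots,\beta_b,\gamma_1,\dots,\gamma_c,\delta_1,\dots,\delta_d,x,y,z$ whose covering relations are $\alpha_i\lessdot\alpha_{i+1}$, $\beta_i\lessdot\beta_{i+1}$, $\gamma_i\lessdot\gamma_{i+1}$,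 $\delta_i\lessdot\delta_{i+1}$ (for all applicable $i$), $x\lessdot\alpha_1$, $x\lessdot\beta_1$, $\beta_b\lessdot y$, $\gamma_c\lessdot y$, $z\lessdot\gamma_1$, and $z\lessdot\delta_1$. *)

(* Defs.v *)
From HB Require Import structures.
From mathcomp Require Import all_boot all_order all_algebra all_fingroup.

Set Implicit Arguments.
Unset Strict Implicit.
Unset Printing Implicit Defensive.

Import Order.TTheory.

Local Open Scope nat_scope.

Section Promotion.
Context {disp : Order.disp_t} {T : finPOrderType disp}.
Implicit Type L : {ffun T -> 'I_#|T|.+1}.

(* Labels live in {0, ..., n} with n = #|T|; an injection avoiding 0 is exactly
   a bijection onto {1, ..., n}. *)
Definition is_labeling L := injectiveb L && [forall x, 0 < L x].

Definition natural L := [forall x, forall y, (x < y)%O ==> (L x < L y)].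

(* The inner [pick] fails exactly when u is maximal, and is unambiguous because
   L is injective. *)
Definition promotion_swap L : {ffun T -> 'I_#|T|.+1} :=
  if [pick u | L u == 1 :> nat] is Some u then
    if [pick v | (u < v)%O && [forall w, (u < w)%O ==> (L v <= L w)]] is Some v
    then [ffun t => L (tperm u v t)]
    else L
  else L.

(* Every effective swap moves the label 1 strictly up, so the process is
   stationary after at most #|T| steps. *)
Definition promotion L : {ffun T -> 'I_#|T|.+1} :=
  let L' := iter #|T| promotion_swap L in
  [ffun t => if L' t == 1 :> nat then ord_max else inord (L' t).-1].

Definition has_order L k :=
  natural (iter k promotion L) &&
  [forall j : 'I_k, ~~ natural (iter j promotion L)].

Definition tangled L := has_order L #|T|.-1.

End Promotion.

Definition tangled_labelings disp (T : finPOrderType disp) :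
  {set {ffun T -> 'I_#|T|.+1}} :=
  [set L | is_labeling L && tangled L].

(* Indices start at 0: Alpha i stands for alpha_(i+1), etc. *)
Inductive W (a b c d : nat) : Type :=
  | Alpha of 'I_a | Beta of 'I_b | Gamma of 'I_c | Delta of 'I_d
  | WX | WY | WZ.
Arguments WX {a b c d}.
Arguments WY {a b c d}.
Arguments WZ {a b c d}.

Section WPoset.
Variables a b c d : nat.
Local Notation W := (W a b c d).

Definition W_code (w : W) : 'I_a + 'I_b + ('I_c + 'I_d) + 'I_3 :=
  match w with
  | Alpha i => inl (inl (inl i))
  | Beta i => inl (inl (inr i))
  | Gamma i => inl (inr (inl i))
  | Delta i => inl (inr (inr i))
  | WX => inr (inord 0)
  | WY => inr (inord 1)
  | WZ => inr (inord 2)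
  end.

Definition W_decode (s : 'I_a + 'I_b + ('I_c + 'I_d) + 'I_3) : W :=
  match s with
  | inl (inl (inl i)) => Alpha _ _ _ i
  | inl (inl (inr i)) => Beta _ _ _ i
  | inl (inr (inl i)) => Gamma _ _ _ i
  | inl (inr (inr i)) => Delta _ _ _ i
  | inr k => if k == 0 :> nat then WX else if k == 1 :> nat then WY else WZ
  end.

Lemma W_codeK : cancel W_code W_decode.
Proof. by case=> //=; rewrite inordK. Qed.

HB.instance Definition _ := Finite.copy W (can_type W_codeK).

Definition W_cover (u v : W) : bool :=
  match u, v with
  | Alpha i, Alpha j => j == i.+1 :> nat
  | Beta i, Beta j => j == i.+1 :> nat
  | Gamma i, Gamma j => j == i.+1 :> nat
  | Delta i, Delta j => j == i.+1 :> nat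
  | WX, Alpha i => i == 0 :> nat
  | WX, Beta i => i == 0 :> nat
  | Beta i, WY => i.+1 == b
  | Gamma i, WY => i.+1 == c
  | WZ, Gamma i => i == 0 :> nat
  | WZ, Delta i => i == 0 :> nat
  | _, _ => false
  end.

Definition W_le : rel W := connect W_cover.

Definition W_height (w : W) : nat :=
  match w with
  | Alpha i | Beta i | Gamma i | Delta i => i.+1
  | WX | WZ => 0
  | WY => (b + c).+1
  end.

Lemma W_cover_height u v : W_cover u v -> W_height u < W_height v.
Proof.
case: u v => [i|i|i|i|||] [j|j|j|j|||] //=; try by move/eqP->.
- by move=> _; rewrite !ltnS (leq_trans (ltn_ord i)) ?leq_addr.
- by move=> _; rewrite !ltnS (leq_trans (ltn_ord i)) ?leq_addl.
Qed.

Lemma W_path_height u p :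
  path W_cover u p -> W_height u + size p <= W_height (last u p).
Proof.
elim: p u => [|v p IHp] u /=; first by rewrite addn0.
case/andP=> /W_cover_height huv /IHp; apply: leq_trans.
by rewrite addnS -addSn leq_add2r.
Qed.

Lemma W_le_refl : reflexive W_le.
Proof. exact: connect0. Qed.

Lemma W_le_anti : antisymmetric W_le.
Proof.
move=> u v /andP[/connectP[p pP vE] /connectP[q qP uE]].
have := W_path_height pP; have := W_path_height qP; rewrite -vE -uE => h1 h2.
have : W_height u + size p <= W_height u.
  exact: leq_trans h2 (leq_trans (leq_addr _ _) h1).
by rewrite -[leqRHS]addn0 leq_add2l leqn0 size_eq0 => /eqP p0; rewrite vE p0.
Qed.

Lemma W_le_trans : transitive W_le.
Proof. exact: connect_trans. Qed.

End WPoset.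

Fact W_display : Order.disp_t. Proof. exact: Order.Disp tt tt. Qed.

HB.instance Definition _ a b c d :=
  Order.Le_isPOrder.Build W_display (W a b c d)
    (@W_le_refl a b c d) (@W_le_anti a b c d) (@W_le_trans a b c d).

(* The division is exact. *)
Definition trinomial (p q r : nat) : nat :=
  (p + q + r)`! %/ (p`! * q`! * r`!).

(* Main.v *)
Require Import Defs.
From HB Require Import structures.
From mathcomp Require Import all_boot all_order all_algebra all_fingroup.
From mathcomp Require Import zify.

Import Order.TTheory GRing.Theory.

Local Open Scope nat_scope.

(** Call token [t] the label that starts as [t] and is decreased by one at each
    promotion, and write [L_k] for the labeling after [k] promotions.  The
    [k]-th promotion lets token [k] go: the hole it leaves moves up, each time
    to the smallest label above it, and stops at a maximal element, which
    receives the label [n].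

    As soon as the label of an element changes
    otherwise than by the shift, that element carries a label smaller than all
    labels above it ([sorted_at_moved]), and this persists
    ([sorted_at_promotion]).  Hence the labels above [n - k] in [L_k] are sorted,
    [L_(n-1)] is natural, and [L] is tangled exactly when in [L_(n-2)] the label
    [2] lies below the label [1] ([tangledP]).  The label [2] is then token [n],
    which can never have moved, so it sits at a minimal element: in the W-poset,
    at [x] or at [z] ([tangled_max_xz]).

    Suppose [L x = n].  Then [L] is tangled iff token [n-1] ends above [x]
    ([final_token]).  Tokens only move down, so this is decided by where token
    [n-1] starts, unless it starts at [y], where it ends among the betas or among
    the gammas and [z].  Let [r] and [s] be the smallest labels on the beta and on
    the gamma chain.  A hole starting in either chain runs up to [y] and pulls
    token [n-1] down into that chain; besides, a hole starting at [z] enters the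
    gammas unless some remaining delta label is smaller than [s].  Following the
    tokens that occupy [z] gives ([tangled_Y]): the labeling is tangled iff
    [r < s] and either [r < L z] or some delta label lies strictly between [r] and
    [s].  Only the relative position of the chains enters the argument, so posets
    are handled through the kind of each element ([W_shaped]).

    Call the labelings with [L x = n], [L y = n-1], [L z < r < s] and no delta
    label between [r] and [s] blocked.  Adding them to the tangled labelings with
    [L x = n] gives the labelings with [L x = n] and token [n-1] on the alphas or
    betas, plus those with [L x = n], [L y = n-1] and [r < s]
    ([count_tangled_x]).  The mirror image of this identity exchanges [x] with [z]
    and [r < s] with [s < r], so that in the sum of both the last terms add up to
    [(n-2)!] ([count_before]), and everything but the blocked labelings adds up to
    [(n-2) (n-2)!] ([count_tangled]).

    A blocked labeling, read in increasing order of labels and with every element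
    replaced by its kind, becomes a word; each word comes from [a! b! c! d!]
    labelings ([count_permutations_map]).  Deleting the alphas and the final
    [y x], which accounts for the binomial factor, leaves a shuffle of [z] with
    [d - j] deltas, then [b - i >= 1] betas, then a gamma, then a shuffle of [i]
    betas, [j] deltas and [c - 1] gammas.  Counting these is the double sum
    ([size_blocked_words]). *)

(** * Sliding the label 1 upwards *)

Section Promotion.
Set Implicit Arguments.
Unset Strict Implicit.
Unset Printing Implicit Defensive.
Context {disp : Order.disp_t} {T : finPOrderType disp}.
Local Notation n := #|T|.
Implicit Types (L M N : {ffun T -> 'I_n.+1}) (t u v w p g e : T).

Lemma labelingP L :
  reflect ((forall u v, L u = L v :> nat -> u = v) /\ forall t, 0 < L t)
          (is_labeling L).
Proof.
apply: (iffP andP) => -[inj pos]; split.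
- by move=> u v /val_inj; apply/injectiveP.
- exact/forallP.
- by apply/injectiveP => u v /(congr1 val); apply: inj.
- exact/forallP.
Qed.

Lemma labeling_inj L u v : is_labeling L -> L u = L v :> nat -> u = v.
Proof. by case/labelingP=> inj _; apply: inj. Qed.

Lemma labeling_gt0 L t : is_labeling L -> 0 < L t.
Proof. by case/labelingP. Qed.

Lemma label_le L t : L t <= n.
Proof. by rewrite -ltnS. Qed.


Lemma labeling_pred_ltn L t : is_labeling L -> (L t).-1 < n.
Proof. by move=> labL; rewrite prednK ?label_le ?labeling_gt0. Qed.

Definition labeling_index L (labL : is_labeling L) t :=
  Ordinal (labeling_pred_ltn t labL).

Lemma labeling_index_inj L (labL : is_labeling L) : injective (labeling_index labL).
Proof.
move=> u v /(congr1 val) /= Euv; apply: (labeling_inj labL).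
by rewrite -(prednK (labeling_gt0 u labL)) Euv prednK ?labeling_gt0.
Qed.

Lemma labeling_onto L m :
  is_labeling L -> 0 < m <= n -> exists t, L t = m :> nat.
Proof.
move=> labL m_bnd.
have [|f' _ f'K] := inj_card_bij (@labeling_index_inj L labL).
  by rewrite card_ord.
have lt_m : m.-1 < n by case/andP: m_bnd => m0 mn; rewrite prednK.
exists (f' (Ordinal lt_m)); have /(congr1 val) /= := f'K (Ordinal lt_m).
have := labeling_gt0 (f' (Ordinal lt_m)) labL. move: m_bnd; case: (L _) => k kP /=; lia.
Qed.

Definition maximal e := [forall w, ~~ (e < w)%O].

Lemma maximalP e : reflect (forall w, ~~ (e < w)%O) (maximal e).
Proof. exact: forallP. Qed.

Record swap_step M N u v : Prop := SwapStep {
  swap_from : M u = 1 :> nat;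
  swap_lt : (u < v)%O;
  swap_min : forall w, (u < w)%O -> w != v -> M v < M w;
  swap_low : N u = M v;
  swap_to : N v = 1 :> nat;
  swap_else : forall t, t != u -> t != v -> N t = M t
}.

Inductive swap_spec L : {ffun T -> 'I_n.+1} -> Prop :=
| SwapStuck u of L u = 1 :> nat & maximal u : swap_spec L L
| SwapMoves M u v of is_labeling M & swap_step L M u v : swap_spec L M.

(** Uniqueness of the smallest label above the hole makes the minimality in
    [swap_step] strict, which is what the invariants below consume. *)
Lemma promotion_swapP L : 0 < n -> is_labeling L -> swap_spec L (promotion_swap L).
Proof.
move=> n0 labL; rewrite /promotion_swap.
case: pickP => [u /eqP Lu|noL]; last first.
  by have [|t Lt] := @labeling_onto L 1 labL; [rewrite n0|have /eqP := noL t].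
case: pickP => [v /andP[ltuv /forallP minv]|nov]; last first.
  apply: (SwapStuck Lu); apply/maximalP => w; apply/negP => ltuw.
  have [w' ltuw' minw'] := @arg_minnP _ w (fun w => (u < w)%O) (fun w => L w : nat) ltuw.
  have /negP := nov w'; apply; rewrite ltuw'; apply/forallP => w''.
  by apply/implyP; apply: minw'.
apply: (@SwapMoves _ _ u v).
  apply/labelingP; split=> [t t'|t]; rewrite !ffunE; last exact: labeling_gt0.
  by move/(labeling_inj labL)/perm_inj.
split=> //.
- move=> w ltuw; apply: contraNltn => le_wv; apply/eqP/(labeling_inj labL).
  by apply/eqP; rewrite eqn_leq le_wv (implyP (minv w)).
- by rewrite ffunE tpermL.
- by rewrite ffunE tpermR.
- by move=> t tu tv; rewrite ffunE tpermD // eq_sym.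
Qed.

Definition slide L := iter n (@promotion_swap _ T) L.

(** Every property of a whole slide is obtained as an invariant of one swap. *)
Lemma slide_ind (Inv : {ffun T -> 'I_n.+1} -> Prop) L :
  0 < n -> is_labeling L -> Inv L ->
  (forall M N u v, is_labeling M -> Inv M -> swap_step M N u v -> Inv N) ->
  is_labeling (slide L) /\ Inv (slide L).
Proof.
move=> n0 labL InvL step.
suff H k : is_labeling (iter k (@promotion_swap _ T) L) /\
           Inv (iter k (@promotion_swap _ T) L) by exact: H.
elim: k => //= k [labM InvM].
case: (promotion_swapP n0 labM) => // N u v labN MN; split=> //.
exact: (step _ N u v labM InvM).
Qed.

Lemma slide_labeling L : 0 < n -> is_labeling L -> is_labeling (slide L).
Proof. by move=> n0 labL; have [] := @slide_ind (fun=> True) L. Qed.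

(** The set of elements above the hole shrinks at each swap, so [#|T|] swaps
    exhaust it. *)
Lemma slide_maximal L e :
  is_labeling L -> slide L e = 1 :> nat -> maximal e.
Proof.
move=> labL; have n0 : 0 < n by apply/card_gt0P; exists e.
suff H k : is_labeling (iter k (@promotion_swap _ T) L) /\
    forall e, iter k (@promotion_swap _ T) L e = 1 :> nat ->
    maximal e \/ #|[set w | (e < w)%O]| + k < n.
  have [_ /[apply]-[//|]] := H n; by rewrite ltnNge leq_addl.
elim: k => [|k [/= labM IH]].
  split=> // e' _; right; rewrite addn0 -cardsT; apply: proper_card.
  by rewrite properT; apply/eqP => /setP/(_ e'); rewrite !inE ltxx.
case: (promotion_swapP n0 labM) => [u Mu maxu|N u v labN].
  by split=> // e' e'1; left; rewrite (labeling_inj labM (etrans e'1 (esym Mu))).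
case=> Mu ltuv _ _ Nv _; split=> // e' e'1.
have -> : e' = v by apply: (labeling_inj labN); rewrite e'1 Nv.
right; have [/maximalP/(_ v)/negP//|lt_n] := IH u Mu.
apply: leq_trans lt_n; rewrite addnS ltnS -addSn leq_add2r; apply: proper_card.
apply/properP; split; last by exists v; rewrite !inE ?ltxx.
by apply/subsetP => w; rewrite !inE; apply: lt_trans.
Qed.

Lemma promotionE L t :
  promotion L t = (if slide L t == 1 :> nat then n else (slide L t).-1) :> nat.
Proof.
rewrite ffunE -/(slide L); case: ifP => // _.
by rewrite inordK // (leq_ltn_trans (leq_pred _)).
Qed.

Lemma promotion_labeling L : is_labeling L -> is_labeling (promotion L).
Proof.
move=> labL; apply/labelingP; split=> [u v|t]; rewrite !promotionE.
  have n0 : 0 < n by apply/card_gt0P; exists u.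
  have labM := slide_labeling n0 labL => E; apply: (labeling_inj labM); move: E.
  have := labeling_gt0 u labM; have := labeling_gt0 v labM.
  by have := label_le (slide L) u; have := label_le (slide L) v; do 2!case: eqP; lia.
have n0 : 0 < n by apply/card_gt0P; exists t.
by have := labeling_gt0 t (slide_labeling n0 labL); case: eqP; lia.
Qed.

(** [stays L t] says that [t] is off the path of the hole: its label is only
    affected by the final shift.  Its negation is the useful notion of being
    moved. *)
Definition stays L t := (1 < L t) && ((promotion L t).+1 == L t).

Lemma staysP L t : is_labeling L ->
  reflect (1 < L t /\ slide L t = L t) (stays L t).
Proof.
move=> labL; have n0 : 0 < n by apply/card_gt0P; exists t.
have := labeling_gt0 t (slide_labeling n0 labL); have := label_le L t.
rewrite /stays promotionE => Ltn slide0; apply: (iffP andP) => -[L1].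
  by move/eqP => E; split=> //; apply: ord_inj; move: E; case: eqP; lia.
by move->; rewrite L1 ifN; [split=> //; lia | lia].
Qed.

Definition sorted_at L v := [forall w, (v < w)%O ==> (L v < L w)].

Lemma sorted_atP L v :
  reflect (forall w, (v < w)%O -> L v < L w) (sorted_at L v).
Proof. by apply: (iffP forallP) => sortv w; apply/implyP/sortv. Qed.

(** [sorted_at] up to the hole, whose label 1 is going to become the largest one;
    this weakening is invariant under swaps. *)
Definition presorted L v :=
  L v = 1 :> nat \/ forall w, (v < w)%O -> L w = 1 :> nat \/ L v < L w.

Lemma presorted_promotion L v :
  is_labeling L -> presorted (slide L) v -> sorted_at (promotion L) v.
Proof.
move=> labL; have n0 : 0 < n by apply/card_gt0P; exists v.
have labM := slide_labeling n0 labL.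
move=> pre; apply/sorted_atP => w ltvw; rewrite !promotionE.
have Lv0 := labeling_gt0 v labM; have Lvn := label_le (slide L) v.
have Lw0 := labeling_gt0 w labM.
case: eqP => [Lv1|Lv1].
  by have /maximalP/(_ w)/negP := slide_maximal labL Lv1.
by case: pre => // /(_ _ ltvw); case: eqP; lia.
Qed.

Lemma presorted_step M N u v t : is_labeling M -> swap_step M N u v ->
  N t = M t \/ presorted N t.
Proof.
move=> labM [Mu ltuv minv Nu Nv Nt].
have [->|tu] := eqVneq t u; last first.
  by have [->|tv] := eqVneq t v; [right; left | left; rewrite Nt].
right; right=> w ltuw; have [->|wv] := eqVneq w v; first by left.
by right; rewrite Nu Nt ?minv // gt_eqF.
Qed.

Lemma presorted_stable M N u v t : is_labeling M -> swap_step M N u v ->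
  presorted M t -> presorted N t.
Proof.
move=> labM [Mu ltuv minv Nu Nv Nt] preM.
have [->|tu] := eqVneq t u.
  right=> w ltuw; have [->|wv] := eqVneq w v; first by left.
  by right; rewrite Nu Nt ?minv // gt_eqF.
have [->|tv] := eqVneq t v; first by left.
case: preM => [Mt|preM].
  by case/eqP: tu; apply: (labeling_inj labM); rewrite Mt Mu.
right=> w lttw; have [->|wv] := eqVneq w v; first by left.
have [wu|wu] := eqVneq w u; last by rewrite !Nt //; apply: preM.
right; rewrite wu Nu Nt //.
case: (preM v); rewrite ?(lt_trans lttw) ?wu // => Mv.
by have := labeling_inj labM (etrans Mv (esym Mu)); move=> E; rewrite E ltxx in ltuv.
Qed.

(** When the hole leaves [v], the label falling into [v] is the smallest one above
    [v]; later swaps only raise labels above [v] or put the hole there. *)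
Lemma sorted_at_moved L v :
  is_labeling L -> ~~ stays L v -> sorted_at (promotion L) v.
Proof.
move=> labL; have n0 : 0 < n by apply/card_gt0P; exists v.
have [||labM] := @slide_ind (fun M =>
  (1 < L v /\ M v = L v) \/ presorted M v) L n0 labL.
  have := labeling_gt0 v labL; rewrite leq_eqVlt => /orP[/eqP L1|]; last by left.
  by right; left.
  move=> M N u w labM IM MN.
  have [NM|] := presorted_step v labM MN; last by right.
  case: IM => [[L1 IM]|preM]; first by left; rewrite NM.
  by right; apply: (presorted_stable labM MN preM).
case=> [stay|pre _]; last exact: presorted_promotion.
by move/(staysP v labL): stay => ->.
Qed.

Lemma sorted_at_promotion L v :
  is_labeling L -> sorted_at L v -> sorted_at (promotion L) v.
Proof.
move=> labL sortv; have n0 : 0 < n by apply/card_gt0P; exists v.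
have [||labM] := @slide_ind (fun M => presorted M v) L n0 labL.
  by right=> w ltvw; right; apply: (sorted_atP _ _ sortv).
  move=> M N u w labM preM MN.
  by apply: (presorted_stable labM MN preM).
exact: presorted_promotion.
Qed.

(** Each swap moves one label down, and all other labels but 1 stay put. *)
Lemma promotion_token_le L p q : is_labeling L ->
  (promotion L q).+1 = L p :> nat -> (q <= p)%O.
Proof.
move=> labL; have n0 : 0 < n by apply/card_gt0P; exists p.
have [||labM] := @slide_ind (fun M =>
  forall q, M q = 1 :> nat \/ exists2 p, (q <= p)%O & M q = L p) L n0 labL.
  by move=> t; right; exists t.
  move=> M N u w labM IM [Mu ltuw _ Nu Nw Nt] t.
  have [->|tw] := eqVneq t w; first by left.
  have [->|tu] := eqVneq t u; last by rewrite Nt.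
  rewrite Nu; case: (IM w) => [|[e lewe ->]]; first by left.
  by right; exists e => //; apply: le_trans lewe; apply: ltW.
move=> /(_ q) tok; rewrite promotionE; have := label_le L p.
have := labeling_gt0 q labM; case: eqP => [_|Mq] Mq0 Lp E; first by lia.
case: tok => // -[e leqe Mqe].
by rewrite (_ : p = e) //; apply: (labeling_inj labL); rewrite -Mqe; lia.
Qed.

(** Once the hole has passed through [g] it only moves further up; its last
    position is maximal and gets the largest label. *)
Lemma moved_end L g : is_labeling L -> ~~ stays L g ->
  exists e, [/\ (g <= e)%O, maximal e & promotion L e = n :> nat].
Proof.
move=> labL; have n0 : 0 < n by apply/card_gt0P; exists g.
have [||labM] := @slide_ind (fun M => 
  (1 < L g /\ M g = L g) \/ exists2 e, (g <= e)%O & M e = 1 :> nat) L n0 labL.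
  have := labeling_gt0 g labL; rewrite leq_eqVlt => /orP[/eqP L1|]; last by left.
  by right; exists g.
  move=> M N u w labM IM [Mu ltuw _ Nu Nw Nt].
  case: IM => [[Lg Mg]|[e lege Me]]; last first.
  have Eeu : e = u by apply: (labeling_inj labM); rewrite Me Mu.
  by right; exists w => //; apply: le_trans (ltW ltuw); rewrite -Eeu.
  have [Egw|gw] := eqVneq g w; first by right; exists w => //; rewrite Egw.
  left; split=> //; rewrite Nt //; apply: contraTneq Lg => Egu.
  by rewrite -Mg Egu Mu.
case=> [stay|[e lege Me] _]; first by move/(staysP g labL): stay => ->.
exists e; split=> //; first exact: slide_maximal Me.
by rewrite promotionE Me.
Qed.

Lemma moved_above_start L u p : is_labeling L -> L u = 1 :> nat ->
  ~~ stays L p -> (u <= p)%O.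
Proof.
move=> labL Lu; have n0 : 0 < n by apply/card_gt0P; exists p.
have [||labM [_ stay]] := @slide_ind (fun M =>
  ((exists2 e, (u <= e)%O & M e = 1 :> nat) /\
   (forall p, ~~ (u <= p)%O -> M p = L p))) L n0 labL.
  by split=> //; exists u.
  move=> M N u' w labM [[e leue Me] IM] [Mu ltuw _ Nu Nw Nt].
  have Eeu : e = u' by apply: (labeling_inj labM); rewrite Me Mu.
  have leuw : (u <= w)%O by apply: le_trans (ltW ltuw); rewrite -Eeu.
  split=> [|t nleut]; first by exists w.
  by rewrite Nt ?IM //; apply: contraNneq nleut => -> //; rewrite -Eeu.
apply: contraNT => nleup; apply/(staysP p labL); split; last exact: stay.
rewrite ltn_neqAle labeling_gt0 // andbT; apply: contraNneq nleup => Lp.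
by rewrite (labeling_inj labL (etrans Lu Lp)).
Qed.

End Promotion.

(** * Tokens under iterated promotion *)

Section Order.
Set Implicit Arguments.
Unset Strict Implicit.
Unset Printing Implicit Defensive.
Context {disp : Order.disp_t} {T : finPOrderType disp}.
Local Notation n := #|T|.
Implicit Types (L M N : {ffun T -> 'I_n.+1}) (t u v w p q g e : T).
Local Notation iterp k L := (iter k (@promotion _ T) L).

Lemma iter_promotion_labeling k L : is_labeling L -> is_labeling (iterp k L).
Proof. by move=> labL; elim: k => //= k; apply: promotion_labeling. Qed.

(** Labels are at most [#|T|] and each promotion shifts them down by one, so an
    element labeled above [#|T| - k] has been moved before; it became sorted at
    that moment ([sorted_at_moved]) and remains so. *)
Lemma sorted_above k L v :
  is_labeling L -> n - k < iterp k L v -> sorted_at (iterp k L) v.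
Proof.
move=> labL; elim: k v => [|k IH] v.
  by rewrite subn0 ltnNge label_le.
rewrite iterS => big.
have labM := iter_promotion_labeling k labL.
have [/andP[_ /eqP M'v]|/(sorted_at_moved labM)//] :=
  boolP (stays (iterp k L) v).
by apply: (sorted_at_promotion labM); apply: IH; rewrite -M'v; lia.
Qed.

Lemma naturalP L : reflect (forall v, sorted_at L v) (natural L).
Proof. exact: forallP. Qed.

Lemma natural_promotion L : is_labeling L -> natural L -> natural (promotion L).
Proof.
by move=> labL /naturalP natL; apply/naturalP => v; apply: sorted_at_promotion.
Qed.

(** After [#|T|.-1] promotions [sorted_above] covers all labels but 1. *)
Lemma natural_pred_card L : is_labeling L -> natural (iterp n.-1 L).
Proof.
move=> labL; apply/naturalP => v.
have labM := iter_promotion_labeling n.-1 labL.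
have := labeling_gt0 v labM; rewrite leq_eqVlt => /orP[/eqP M1|M2].
  apply/sorted_atP => w ltvw; rewrite -M1 ltn_neqAle labeling_gt0 // andbT M1.
  by apply: contraTneq ltvw => /(labeling_inj labM) ->; rewrite ltxx.
by apply: sorted_above => //; apply: leq_trans M2; rewrite ltnS; lia.
Qed.

(** Naturality is never lost, so the order is [n-1] as soon as [n-2] promotions
    are not enough. *)
Lemma natural_le i k L : is_labeling L -> i <= k ->
  natural (iterp i L) -> natural (iterp k L).
Proof.
move=> labL /subnK <- nati; elim: (k - i) => //= j.
by apply: natural_promotion; apply: iter_promotion_labeling.
Qed.

Lemma tangledE L : is_labeling L -> 1 < n ->
  tangled L = ~~ natural (iterp n.-2 L).
Proof.
move=> labL n1; rewrite /tangled /has_order natural_pred_card //=.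
apply/forallP/idP => [nonat|nonat [j ltj]].
  have lt2 : n.-2 < n.-1 by lia.
  exact: (nonat (Ordinal lt2)).
by apply: contraNN nonat; apply: natural_le => //=; lia.
Qed.

(** After [n-2] promotions all labels from 3 on are sorted, and only the labels 1
    and 2 can be out of order. *)
Lemma tangledP L : is_labeling L -> 1 < n ->
  reflect (exists u v, [/\ (u < v)%O, iterp n.-2 L u = 2 :> nat
                         & iterp n.-2 L v = 1 :> nat])
          (tangled L).
Proof.
move=> labL n1; rewrite tangledE //.
have labM := iter_promotion_labeling n.-2 labL.
apply: (iffP idP) => [|[u [v [ltuv Mu Mv]]]]; last first.
  by apply/naturalP => /(_ u)/sorted_atP/(_ v ltuv); rewrite Mu Mv.
rewrite negb_forall => /existsP[u]; rewrite negb_forall => /existsP[v].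
rewrite negb_imply -leqNgt => /andP[ltuv leMvu].
have Mneq : iterp n.-2 L v != iterp n.-2 L u :> nat.
  by apply: contraTneq ltuv => /(labeling_inj labM) ->; rewrite ltxx.
have Mu : iterp n.-2 L u <= 2.
  rewrite leqNgt; apply/negP => gt2.
  have /sorted_atP/(_ v ltuv) : sorted_at (iterp n.-2 L) u.
    by apply: sorted_above => //; apply: leq_trans gt2; lia.
  by rewrite ltnNge leMvu.
by exists u, v; have := labeling_gt0 v labM; split=> //; lia.
Qed.

(** Here [p] and [q] are the positions of one token at times [i] and [k]. *)
Lemma token_le i k L p q : is_labeling L -> i <= k ->
  iterp k L q + k = iterp i L p + i -> (q <= p)%O.
Proof.
move=> labL /subnK <-; elim: (k - i) q => [|j IH] q.
  rewrite add0n => /addIn E.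
  by rewrite (labeling_inj (iter_promotion_labeling i labL) E).
rewrite addSn iterS => E; set M := iterp (j + i) L.
have labM : is_labeling M by apply: iter_promotion_labeling.
have [|r Mr] := @labeling_onto _ _ M (promotion M q).+1 labM.
  have := label_le (iterp i L) p; move: E; rewrite -/M; lia.
apply: le_trans (promotion_token_le labM (esym Mr)) _.
by apply: IH; rewrite -/M Mr -E -/M; lia.
Qed.

Lemma token_le0 k L p q : is_labeling L ->
  iterp k L q + k = L p -> (q <= p)%O.
Proof. by move=> labL E; apply: (token_le labL (leq0n k)); rewrite addn0. Qed.

(** Token [n] has label 2 after [n-2] promotions.  Had it moved, its element would
    be sorted and could not lie below the label 1; so it has not moved, and an
    element below it would carry a label at least 3 while being sorted. *)
Lemma tangled_max_minimal L p r : is_labeling L -> 1 < n ->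
  tangled L -> L p = n :> nat -> ~~ (r < p)%O.
Proof.
move=> labL n1 tangL Lp.
have [u [v [ltuv Mu Mv]]] := tangledP labL n1 tangL.
have labM := iter_promotion_labeling n.-2 labL.
have moved k q : k <= n.-2 -> iterp k L q = n - k :> nat ->
    q = p \/ sorted_at (iterp k L) q.
  elim: k q => [|k IH] q lek.
    by rewrite subn0 => Lq; left; apply: (labeling_inj labL) (etrans Lq (esym Lp)).
  have labk := iter_promotion_labeling k labL; rewrite iterS.
  have [/andP[_ /eqP M'q]|] := boolP (stays (iterp k L) q); last first.
    by right; apply: sorted_at_moved.
  move=> M'k; have [||->|sortq] := IH q; [lia|rewrite -M'q M'k; lia|by left|right].
  exact: sorted_at_promotion.
have [||<-|/sorted_atP/(_ v ltuv)] := moved n.-2 u; rewrite ?Mu ?Mv //; first by lia.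
apply/negP => ltru.
have lt2 : 2 < iterp n.-2 L r.
  have := labeling_gt0 r labM; rewrite leq_eqVlt => /orP[/eqP M1|].
    have Erv := labeling_inj labM (etrans (esym M1) (esym Mv)).
    by have := lt_trans ltru ltuv; rewrite Erv ltxx.
  rewrite leq_eqVlt => /orP[/eqP M2|//].
  by have := labeling_inj labM (etrans (esym M2) (esym Mu)) => E; rewrite E ltxx in ltru.
have /sorted_atP/(_ u ltru) : sorted_at (iterp n.-2 L) r.
  by apply: sorted_above => //; apply: leq_trans lt2; lia.
by rewrite Mu; lia.
Qed.

(** Tokens only move down, hence a token on a minimal element waits there until
    its own turn. *)
Lemma minimal_fixed k L p : is_labeling L -> (forall r, ~~ (r < p)%O) ->
  k < L p -> iterp k L p + k = L p.
Proof.
move=> labL minp ltk; have labM := iter_promotion_labeling k labL.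
have [|q Mq] := @labeling_onto _ _ (iterp k L) (L p - k) labM.
  by have := label_le L p; lia.
have : (q <= p)%O by apply: (@token_le0 k L p q labL); rewrite Mq; lia.
by rewrite le_eqVlt (negPf (minp q)) orbF => /eqP Eqp; rewrite -{1}Eqp Mq; lia.
Qed.

Lemma tangled_max_minimalE L p : is_labeling L -> 1 < n ->
  L p = n :> nat -> (forall r, ~~ (r < p)%O) ->
  reflect (exists2 v, iterp n.-2 L v = 1 :> nat & (p < v)%O) (tangled L).
Proof.
move=> labL n1 Lp minp.
have labM := iter_promotion_labeling n.-2 labL.
have Mp : iterp n.-2 L p = 2 :> nat.
  by have := @minimal_fixed n.-2 L p labL minp; lia.
apply: (iffP (tangledP labL n1)) => [[u [v [ltuv Mu Mv]]]|[v Mv ltpv]].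
  by exists v => //; rewrite (labeling_inj labM (etrans Mp (esym Mu))).
by exists p, v.
Qed.

End Order.

Section Trajectory.
Set Implicit Arguments.
Unset Strict Implicit.
Unset Printing Implicit Defensive.
Context {disp : Order.disp_t} {T : finPOrderType disp}.
Implicit Types (t u v w p q g e : T).

(** A plain natural number, so that arithmetic never meets the type ['I_#|T|.+1];
    the facts below restate the above with a number [n] in place of [#|T|]. *)
Definition label_at (L : {ffun T -> 'I_#|T|.+1}) k t : nat :=
  iter k (@promotion _ T) L t.

Variables (L : {ffun T -> 'I_#|T|.+1}) (n : nat).
Hypotheses (labL : is_labeling L) (cardT : #|T| = n).
Local Notation lab := (label_at L).

Definition still k t := (1 < lab k t) && ((lab k.+1 t).+1 == lab k t).

Let labM k := iter_promotion_labeling k labL.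

Lemma lab_gt0 k t : 0 < lab k t.
Proof. exact: (labeling_gt0 t (labM k)). Qed.

Lemma lab_le k t : lab k t <= n.
Proof. by rewrite -cardT; apply: label_le. Qed.

Lemma lab_inj k u v : lab k u = lab k v -> u = v.
Proof. exact: (labeling_inj (labM k)). Qed.

Lemma lab_onto k m : 0 < m <= n -> exists t, lab k t = m.
Proof. by rewrite -cardT => /(labeling_onto (labM k)). Qed.

Lemma lab_token k m : k < m <= n -> exists t, lab k t + k = m.
Proof.
move=> bnd; have [|t Mt] := @lab_onto k (m - k); first by lia.
by exists t; rewrite Mt subnK; lia.
Qed.

Lemma lab_token_le i k p q : i <= k -> lab k q + k = lab i p + i -> (q <= p)%O.
Proof. exact: (token_le labL). Qed.

Lemma lab_minimal k p : (forall r, ~~ (r < p)%O) -> k < lab 0 p ->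
  lab k p + k = lab 0 p.
Proof. exact: (minimal_fixed labL). Qed.

Lemma lab_moved_end k g : ~~ still k g ->
  exists e, [/\ (g <= e)%O, maximal e & lab k.+1 e = n].
Proof. by rewrite -cardT => /(moved_end (labM k)). Qed.

Lemma lab_moved_above k u p : lab k u = 1 -> ~~ still k p -> (u <= p)%O.
Proof. exact: (moved_above_start (labM k)). Qed.

Definition lab_sorted k v := forall w, (v < w)%O -> lab k v < lab k w.

Lemma lab_sorted_moved k v : ~~ still k v -> lab_sorted k.+1 v.
Proof. by move/(sorted_at_moved (labM k))/sorted_atP. Qed.

Lemma lab_sortedS k v : lab_sorted k v -> lab_sorted k.+1 v.
Proof. by move/sorted_atP/(sorted_at_promotion (labM k))/sorted_atP. Qed.

Lemma tangled_minimal p r : 1 < n -> tangled L -> lab 0 p = n -> ~~ (r < p)%O.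
Proof. by rewrite -cardT; apply: tangled_max_minimal. Qed.

Lemma tangled_minimalP p : 1 < n -> lab 0 p = n -> (forall r, ~~ (r < p)%O) ->
  reflect (exists2 v, lab n.-2 v = 1 & (p < v)%O) (tangled L).
Proof. by rewrite -cardT; apply: tangled_max_minimalE. Qed.

End Trajectory.

(** * Tangled labelings of W-shaped posets *)

(** [KA] to [KD] stand for the chains alpha to delta. *)
Variant kind := KA | KB | KC | KD | KX | KY | KZ.

Definition kind_code k : nat :=
  match k with KA => 0 | KB => 1 | KC => 2 | KD => 3 | KX => 4 | KY => 5 | KZ => 6 end.

Lemma kind_code_inj : injective kind_code.
Proof. by case=> -[]. Qed.

HB.instance Definition _ := Equality.copy kind (inj_type kind_code_inj).

(** The kinds that can occur at the two ends of a strict inequality; within one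
    chain any order is allowed. *)
Definition kind_lt k k' : bool :=
  match k, k' with
  | KX, (KA | KB | KY) | KZ, (KC | KD | KY) | KB, (KB | KY) | KC, (KC | KY)
  | KA, KA | KD, KD => true
  | _, _ => false
  end.

Section Shape.
Set Implicit Arguments.
Unset Strict Implicit.
Unset Printing Implicit Defensive.

(** The order inside each of the four parts is left free: what follows depends on
    their sizes only. *)
Record W_shaped {disp : Order.disp_t} {T : finPOrderType disp}
    (kd : T -> kind) (x y z : T) : Prop := WShaped {
  shape_x : forall t, (kd t == KX) = (t == x);
  shape_y : forall t, (kd t == KY) = (t == y);
  shape_z : forall t, (kd t == KZ) = (t == z);
  shape_lt : forall u v, (u < v)%O -> kind_lt (kd u) (kd v);
  shape_kind_lt : forall u v, kind_lt (kd u) (kd v) -> kd u != kd v -> (u < v)%O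
}.

Definition first_of {T : finType} {m} (kd : T -> kind) (L : {ffun T -> 'I_m}) k g :=
  (kd g == k) && [forall h, (kd h == k) ==> (L g <= L h)].

Context {disp : Order.disp_t} {T : finPOrderType disp}.
Variables (kd : T -> kind) (x y z : T).
Hypothesis WT : W_shaped kd x y z.
Variables (L : {ffun T -> 'I_#|T|.+1}) (m : nat).
Hypotheses (labL : is_labeling L) (cardT : #|T| = m.+2).
Local Notation n := m.+2.
Implicit Types (t u v w p q g e : T).
Local Notation lab := (label_at L).

Let kdx : kd x = KX. Proof. by apply/eqP; rewrite (shape_x WT). Qed.
Let kdy : kd y = KY. Proof. by apply/eqP; rewrite (shape_y WT). Qed.
Let kdz : kd z = KZ. Proof. by apply/eqP; rewrite (shape_z WT). Qed.

Lemma kind_le u v : (u <= v)%O -> kd u = kd v \/ kind_lt (kd u) (kd v).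
Proof.
rewrite le_eqVlt => /orP[/eqP->|/(shape_lt WT)]; [by left | by right].
Qed.

Lemma x_minimal r : ~~ (r < x)%O.
Proof. by apply/negP => /(shape_lt WT); rewrite kdx; case: (kd r). Qed.

Lemma z_minimal r : ~~ (r < z)%O.
Proof. by apply/negP => /(shape_lt WT); rewrite kdz; case: (kd r). Qed.

Lemma minimal_xz p : (forall r, ~~ (r < p)%O) -> p = x \/ p = z.
Proof.
move=> minp; case Ep: (kd p).
- by case/negP: (minp x); apply: (shape_kind_lt WT); rewrite kdx Ep.
- by case/negP: (minp x); apply: (shape_kind_lt WT); rewrite kdx Ep.
- by case/negP: (minp z); apply: (shape_kind_lt WT); rewrite kdz Ep.
- by case/negP: (minp z); apply: (shape_kind_lt WT); rewrite kdz Ep.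
- by left; apply/eqP; rewrite -(shape_x WT) Ep.
- by case/negP: (minp x); apply: (shape_kind_lt WT); rewrite kdx Ep.
- by right; apply/eqP; rewrite -(shape_z WT) Ep.
Qed.

Lemma W_shaped_card_gt2 : 0 < m.
Proof.
suff : size [:: x; y; z] <= #|T| by rewrite cardT.
rewrite cardE.
apply: uniq_leq_size => [|t _]; last by rewrite mem_enum.
by rewrite /= !inE -(shape_y WT) -!(shape_z WT) kdx kdy.
Qed.
Let m0 := W_shaped_card_gt2.

Lemma tangled_max_xz : tangled L -> lab 0 x = n \/ lab 0 z = n.
Proof.
move=> tangL; have [|p Lp] := lab_onto labL cardT 0 (m := n); first by rewrite leqnn.
have minp r := tangled_minimal labL cardT r isT tangL Lp.
by have [Ep|Ep] := minimal_xz minp; [left | right]; rewrite -Ep.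
Qed.

Hypothesis Lx : lab 0 x = n.

Lemma x_fixed k : k < n -> lab k x + k = n.
Proof. by rewrite -Lx; apply: lab_minimal x_minimal. Qed.

(** Token [n], at [x], has label 2 after [n-2] promotions, so everything depends on
    where the label 1, which is token [n-1], has arrived. *)
Lemma final_token p : lab 0 p = m.+1 ->
  exists v, [/\ lab m v = 1, (v <= p)%O, v != x & tangled L = (x < v)%O].
Proof.
move=> Lp; have [|v Mv] := lab_onto labL cardT m (m := 1); first by [].
exists v; split=> //.
- by apply: (lab_token_le labL (leq0n m)); rewrite Mv Lp; lia.
- by apply: contra_eq_neq Mv => ->; have := @x_fixed m; lia.
apply/(tangled_minimalP labL cardT isT Lx x_minimal)/idP => [[w Mw]|ltxv].
  by rewrite (lab_inj labL (etrans Mv (esym Mw))).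
by exists v.
Qed.

Lemma above_x v : v != x -> (x < v)%O = (kd v \in [:: KA; KB; KY]).
Proof.
move=> nvx; apply/idP/idP => [/(shape_lt WT)|]; first by rewrite kdx; case: (kd v).
by move=> kdv; apply: (shape_kind_lt WT); rewrite kdx; move: kdv; case: (kd v).
Qed.

(** Below an alpha or a beta there are only alphas, betas and [x], and [x] is
    taken by token [n]. *)
Lemma tangled_AB p : lab 0 p = m.+1 -> kd p \in [:: KA; KB] -> tangled L.
Proof.
move=> Lp kdp; have [v [Mv levp nvx ->]] := final_token Lp.
rewrite above_x //; move: nvx; rewrite -(shape_x WT).
by case: (kind_le levp) kdp => [->|]; case: (kd p) => //; case: (kd v).
Qed.

Lemma untangled_CDZ p : lab 0 p = m.+1 -> kd p \in [:: KC; KD; KZ] -> ~~ tangled L.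
Proof.
move=> Lp kdp; have [v [Mv levp nvx ->]] := final_token Lp.
rewrite above_x //; move: nvx; rewrite -(shape_x WT).
by case: (kind_le levp) kdp => [->|]; case: (kd p) => //; case: (kd v).
Qed.

Hypothesis Ly : lab 0 y = m.+1.
Variables g h : T.
Hypotheses (first_g : first_of kd L KB g) (first_h : first_of kd L KC h).

Let kdg : kd g = KB. Proof. by case/andP: first_g => /eqP. Qed.
Let kdh : kd h = KC. Proof. by case/andP: first_h => /eqP. Qed.
Let Lg v : kd v = KB -> lab 0 g <= lab 0 v.
Proof. by move=> kdv; case/andP: first_g => _ /forallP/(_ v); rewrite kdv. Qed.
Let Lh v : kd v = KC -> lab 0 h <= lab 0 v.
Proof. by move=> kdv; case/andP: first_h => _ /forallP/(_ v); rewrite kdv. Qed.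
Let lab0_neq u v : kd u != kd v -> lab 0 u != lab 0 v.
Proof. by apply: contraNneq => /(lab_inj labL) ->. Qed.

(** Token [n-1] is still at [y] after [k] promotions. *)
Definition at_y k := lab k y + k == m.+1.

Lemma at_y_le i k : i <= k -> at_y k -> at_y i.
Proof.
move=> leik /eqP yk; have y0 := lab_gt0 labL k y.
have [|p Mp] := lab_token labL cardT (k := i) (m := m.+1); first by lia.
have leyp : (y <= p)%O by apply: (lab_token_le labL leik); lia.
have lepy : (p <= y)%O by apply: (lab_token_le labL (leq0n i)); lia.
have Epy : p = y by apply/eqP; rewrite eq_le leyp lepy.
by rewrite /at_y -Epy Mp.
Qed.

Lemma end_y u e : kd u \in [:: KB; KC; KY] -> (u <= e)%O -> maximal e -> e = y.
Proof.
move=> kdu leue /maximalP maxe; apply/eqP; rewrite -(shape_y WT).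
apply/negPn/negP => ney; case/negP: (maxe y); apply: (shape_kind_lt WT); rewrite kdy //.
by case: (kind_le leue) kdu ney => [<-|]; case: (kd u) => //; case: (kd e).
Qed.

(** The only maximal element above a beta or a gamma is [y], so a hole passing
    through one of them ends at [y]. *)
Lemma moved_y k u : at_y k -> kd u \in [:: KB; KC] -> ~~ still L k u ->
  ~~ still L k y.
Proof.
move=> /eqP yk kdu /(lab_moved_end labL cardT)[e [leue maxe Pe]].
have Ee : e = y by apply: (end_y _ leue maxe); move: kdu; case: (kd u).
have ley := lab_le L cardT k y; rewrite Ee in Pe.
by rewrite /still Pe; lia.
Qed.

Lemma at_yS k : at_y k -> k < m -> at_y k.+1 = still L k y.
Proof. by rewrite /at_y /still; lia. Qed.

(** As long as token [n-1] stays at [y], no hole has visited the betas and the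
    gammas. *)
Lemma BC_fixed k u : k <= m -> at_y k -> kd u \in [:: KB; KC] ->
  k < lab 0 u /\ lab k u + k = lab 0 u.
Proof.
move=> + + kdu; elim: k => [|k IH] lek yk.
  by rewrite addn0; split=> //; apply: lab_gt0.
have yk' := at_y_le (leqnSn k) yk; have [|ltk Mu] := IH _ yk'; first by lia.
have : still L k u.
  by apply: contraTT (yk) => /(moved_y yk' kdu); rewrite at_yS.
by rewrite /still; lia.
Qed.

Lemma start_below_B k s u : lab k s = 1 -> k < m.+1 -> kd u = KB ->
  ~~ still L k u -> kd s = KB.
Proof.
move=> Ms ltk kdu /(lab_moved_above labL Ms)/kind_le; rewrite kdu => -[//|].
case Es: (kd s) => // _; have /eqP Esx : s == x by rewrite -(shape_x WT) Es.
by have := @x_fixed k; rewrite -Esx Ms; lia.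
Qed.

(** A hole reaches the betas only from the betas themselves, since [x] keeps token
    [n].  So betas do not change before step [lab 0 g], wherever token [n-1] is. *)
Lemma B_fixed k u : k < lab 0 g -> k <= m -> kd u = KB -> lab k u + k = lab 0 u.
Proof.
elim: k u => [|k IH] u ltk lek kdu; first by rewrite addn0.
have Mu : lab k u + k = lab 0 u by apply: IH => //; lia.
suff : still L k u by rewrite /still; lia.
apply/negPn/negP => moved_u.
have [|s Ms] := lab_onto labL cardT k (m := 1); first by lia.
have kds : kd s = KB by apply: (start_below_B Ms _ kdu moved_u); lia.
have Ls := Lg kds; have : lab k s + k = lab 0 s by apply: IH => //; lia.
by lia.
Qed.

Lemma first_B_le : lab 0 g <= m.
Proof.
have := lab_le L cardT 0 g.
have := @lab0_neq g x; have := @lab0_neq g y; rewrite kdg kdx kdy Lx Ly.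
by move=> /(_ isT) + /(_ isT); lia.
Qed.

(** At step [k.+1] the hole starts at the beta [g] and ends at [y]; token [n-1]
    moves to an element on the path of the hole, hence to a beta, and can only
    end at a beta. *)
Lemma tangled_still_at_y k : lab 0 g = k.+1 -> at_y k -> tangled L.
Proof.
move=> Ek yk; have Lgn := first_B_le; have yk1 := eqP yk.
have [v [Mv levy nvx ->]] := final_token Ly; rewrite above_x //.
have Mg : lab k g = 1.
  have : lab k g + k = lab 0 g by apply: B_fixed => //; lia.
  by lia.
have moved_g : ~~ still L k g by rewrite /still Mg.
have [e [lege maxe Pe]] := lab_moved_end labL cardT moved_g.
have Ee : e = y by apply: (end_y _ lege maxe); rewrite kdg.
rewrite {e maxe}Ee in lege Pe.
have [|y' My'] := lab_token labL cardT (k := k.+1) (m := m.+1); first by lia.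
have ny' : y' != y by apply/eqP => Ey'; move: My'; rewrite Ey'; lia.
have legy' : (g <= y')%O.
  apply: (lab_moved_above labL Mg); rewrite /still; apply/negP => still_y'.
  by case/eqP: ny'; apply: (lab_inj labL (k := k)); lia.
have kdy' : kd y' = KB.
  move: ny'; rewrite -(shape_y WT).
  by case: (kind_le legy') => [<-|]; rewrite kdg //; case: (kd y').
have lekm : k.+1 <= m by rewrite -Ek.
have levy' : (v <= y')%O.
  by apply: (lab_token_le labL lekm); rewrite Mv My'.
move: nvx; rewrite -(shape_x WT).
by case: (kind_le levy') => [->|]; rewrite kdy' //; case: (kd v).
Qed.

(** When token [n-1] leaves [y] the betas are still untouched, so it goes to the
    gammas or to [z], and never gets above [x] again. *)
Lemma untangled_left_y k0 : lab 0 g = k0.+1 -> ~~ at_y k0 -> ~~ tangled L.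
Proof.
move=> Ek0 nyk; have Lgn := first_B_le.
have [v [Mv levy nvx ->]] := final_token Ly.
rewrite above_x //; have : exists k, ~~ at_y k by exists k0.
case/ex_minnP => -[|k nyk1 mink]; first by rewrite /at_y addn0 Ly eqxx.
have yk : at_y k by apply/negPn/negP => /mink; lia.
have ltkg : k.+1 < lab 0 g by rewrite Ek0 ltnS mink.
have lekm : k.+1 <= m := leq_trans (ltnW ltkg) Lgn.
have [|y' My'] := lab_token labL cardT (k := k.+1) (m := m.+1).
  by rewrite ltnS lekm leqnSn.
have ny' : y' != y.
  by apply: contraNneq nyk1 => Ey'; rewrite /at_y -Ey' My'.
have ley'y : (y' <= y)%O by apply: (lab_token_le labL (leq0n k.+1)); rewrite My' Ly addn0.
have levy' : (v <= y')%O by apply: (lab_token_le labL lekm); rewrite Mv My'.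
have nB : kd y' <> KB.
  move=> kdy'; have Ey' : lab k.+1 y' + k.+1 = lab 0 y' by apply: B_fixed.
  by case/eqP: ny'; apply: (lab_inj labL (k := 0)); rewrite Ly -Ey' My'.
have ny'x : y' != x.
  by apply/eqP => Ey'; have := @x_fixed k.+1; rewrite -Ey' My'; clear -lekm; lia.
move: nvx ny' ny'x; rewrite -!(shape_x WT) -(shape_y WT).
case: (kind_le levy') => [->|]; case: (kind_le ley'y) => [->|]; rewrite ?kdy //;
  by case: (kd y') nB => //; case: (kd v).
Qed.

(** From the step of its own token on, [z] always holds the smallest label of its
    upper set: a hole starting at [z] restores this. *)
Lemma z_sorted k : lab 0 z <= k -> lab_sorted L k z.
Proof.
have Lz0 := lab_gt0 labL 0 z.
elim: k => [|k IH]; first by lia.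
rewrite leq_eqVlt ltnS => /orP[/eqP Ek|/IH]; last exact: lab_sortedS.
apply: (lab_sorted_moved labL); rewrite /still.
have : lab k z + k = lab 0 z by apply: (lab_minimal labL z_minimal); lia.
by lia.
Qed.

(** While token [n-1] stays at [y] the gammas keep their own tokens, so the token
    at [z] can only come from a delta or from [z] itself. *)
Lemma z_token_origin k : k <= m -> at_y k -> lab k z + k <= n ->
  exists2 v0, lab 0 v0 = lab k z + k & kd v0 = KD \/ v0 = z.
Proof.
move=> lek yk Mvn; have Mz0 := lab_gt0 labL k z.
have [|v0 Lv0] := lab_onto labL cardT 0 (m := lab k z + k); first by lia.
exists v0 => //.
have levv0 : (z <= v0)%O by apply: (lab_token_le labL (leq0n k)); lia.
have nfix : lab k v0 + k = lab 0 v0 -> v0 = z.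
  by move=> Ev0; apply: (lab_inj labL (k := k)); lia.
case Ev0: (kd v0).
- by case: (kind_le levv0); rewrite Ev0 kdz.
- by right; apply: nfix; case: (@BC_fixed k v0) => //; rewrite Ev0.
- by right; apply: nfix; case: (@BC_fixed k v0) => //; rewrite Ev0.
- by left.
- by case: (kind_le levv0); rewrite Ev0 kdz.
- right; apply: nfix; have /eqP -> : v0 == y by rewrite -(shape_y WT) Ev0.
  by rewrite (eqP yk) Ly.
- by right; apply/eqP; rewrite -(shape_z WT) Ev0.
Qed.

(** If [z] has already been processed, the token now at [z] is smaller than the
    gamma token [lab 0 h] and not yet processed: it is the required delta token. *)
Lemma at_y_first_B_only_if k : lab 0 g = k.+1 -> at_y k ->
  lab 0 g < lab 0 h /\
  (lab 0 g < lab 0 z \/ exists2 t, kd t = KD & lab 0 g < lab 0 t < lab 0 h).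
Proof.
move=> Ek yk; have Lgn := first_B_le; have lek : k <= m by lia.
have [ltkh Mh] : k < lab 0 h /\ lab k h + k = lab 0 h by apply: BC_fixed; rewrite ?kdh.
have [_ Mg] : k < lab 0 g /\ lab k g + k = lab 0 g by apply: BC_fixed; rewrite ?kdg.
have Lgh : lab 0 g != lab 0 h by apply: lab0_neq; rewrite kdg kdh.
have Lgz : lab 0 g != lab 0 z by apply: lab0_neq; rewrite kdg kdz.
split; first by lia.
have [|leLz] := ltnP (lab 0 g) (lab 0 z); [by left | right].
have ltzh : (z < h)%O by apply: (shape_kind_lt WT); rewrite kdz kdh.
have leLzk : lab 0 z <= k by lia.
have ltMz := z_sorted leLzk ltzh; have leh := lab_le L cardT 0 h.
have [|v0 Lv0 kdv0] := @z_token_origin k lek yk; first by lia.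
have Mz0 := lab_gt0 labL k z.
have nMz : lab k z != lab k g.
  by apply: contraTneq isT => /(lab_inj labL) Ezg; have := kdg; rewrite -Ezg kdz.
exists v0; last by lia.
by case: kdv0 => // Ev0; rewrite Ev0 in Lv0; lia.
Qed.

(** A hole that reaches [y] starts below [y], and betas and gammas are not due
    before step [lab 0 g]. *)
Lemma leave_y_start j : at_y j -> ~~ at_y j.+1 ->
  j.+1 < lab 0 g -> lab 0 g < lab 0 h -> lab j z = 1.
Proof.
move=> yj nyj1 ltjg ltgh; have Lgn := first_B_le.
have [|s Ms] := lab_onto labL cardT j (m := 1); first by lia.
have moved_y' : ~~ still L j y by rewrite -at_yS //; lia.
have lesy := lab_moved_above labL Ms moved_y'.
have nBC : kd s \notin [:: KB; KC].
  apply/negP => kds; have [|_ Es] := @BC_fixed j s _ yj kds; first by lia.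
  have : lab 0 g <= lab 0 s; last by lia.
  by move: kds; rewrite !inE => /orP[/eqP/Lg//|/eqP/Lh]; lia.
have ny : s != y by apply/eqP => E; move: yj; rewrite /at_y -E Ms; lia.
have nx : s != x by apply/eqP => E; have := @x_fixed j; rewrite -E Ms; lia.
suff /eqP <- : s == z by [].
move: nBC ny nx; rewrite -(shape_x WT) -(shape_y WT) -(shape_z WT).
by case: (kind_le lesy) => [->|]; rewrite kdy //; case: (kd s).
Qed.

(** If token [n-1] left [y] before step [lab 0 g], the hole would start at [z]
    ([leave_y_start]), which is impossible while [z] waits for its own token.  If
    a delta token is smaller than all gamma tokens, the token falling into [z]
    comes from some delta [v]; the hole passes through [v] and ends at a maximal
    element above a delta, which is not [y]. *)
Lemma at_y_first_B_if k : lab 0 g = k.+1 -> lab 0 g < lab 0 h ->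
  (lab 0 g < lab 0 z \/ exists2 t, kd t = KD & lab 0 g < lab 0 t < lab 0 h) ->
  at_y k.
Proof.
move=> Ek; have Lgn := first_B_le.
move=> ltgh gz_or; apply/negPn/negP => nyk.
have : exists k, ~~ at_y k by exists k.
case/ex_minnP => -[|j nyj1 minj]; first by rewrite /at_y addn0 Ly eqxx.
have yj : at_y j by apply/negPn/negP => /minj; lia.
have ltjg : j.+1 < lab 0 g by have := minj _ nyk; lia.
(* [j.+1] is the first step that moves token [n-1] away from [y] *)
have Mz := leave_y_start yj nyj1 ltjg ltgh.
have leLz : lab 0 z <= j.+1.
  rewrite leqNgt; apply/negP => ltj.
  by have := lab_minimal labL z_minimal (ltnW ltj); lia.
have [t kdt ltgt] : exists2 t, kd t = KD & lab 0 g < lab 0 t < lab 0 h.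
  by case: gz_or => // ltgz; lia.
have leh := lab_le L cardT 0 h.
have [|q Mq] := lab_token labL cardT (k := j.+1) (m := lab 0 t); first by lia.
have leqt : (q <= t)%O by apply: (lab_token_le labL (leq0n j.+1)); lia.
have moved_z : ~~ still L j z by rewrite /still Mz.
have lezq : lab j.+1 z <= lab j.+1 q.
  have [->//|nqz] := eqVneq q z; apply/ltnW/(lab_sorted_moved labL moved_z).
  apply: (shape_kind_lt WT); rewrite kdz; move: nqz; rewrite -(shape_z WT);
  by case: (kind_le leqt) => [->|]; rewrite kdt //; case: (kd q).
have Mz0 := lab_gt0 labL j.+1 z.
have [|v Mv] := lab_onto labL cardT j (m := (lab j.+1 z).+1); first by lia.
have lezv : (z <= v)%O by apply: (lab_token_le labL (leqnSn j)); lia.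
have nvz : v != z by apply/eqP => E; move: Mv; rewrite E Mz; lia.
have kdv : kd v = KD.
  move: nvz; rewrite -(shape_z WT).
  case: (kind_le lezv) => [<-|]; rewrite kdz ?eqxx //.
  case Ev: (kd v) => // _ _.
    have [||_ Ev0] := @BC_fixed j v _ yj; rewrite ?Ev //; first by lia.
    by have := Lh Ev; lia.
  have /eqP Evy : v == y by rewrite -(shape_y WT) Ev.
  have := yj; rewrite /at_y -Evy Mv => Eyj.
  have Lty : lab 0 t != lab 0 y by apply: lab0_neq; rewrite kdt kdy.
  by lia.
have moved_v : ~~ still L j v.
  apply/negP; rewrite /still => still_v; case/eqP: nvz.
  by apply: (lab_inj labL (k := j.+1)); lia.
have moved_y' : ~~ still L j y.
  by rewrite -at_yS // (leq_trans _ Lgn) // ltnW.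
have [e [leve _ Pe]] := lab_moved_end labL cardT moved_v.
have [e' [leye' maxe' Pe']] := lab_moved_end labL cardT moved_y'.
have Ee' : e' = y by apply: (end_y _ leye' maxe'); rewrite kdy.
have Ee : e = y by rewrite -Ee'; apply: (lab_inj labL (k := j.+1)); rewrite Pe Pe'.
by have := kind_le leve; rewrite Ee kdv kdy; case.
Qed.

Lemma tangled_Y :
  tangled L =
  (L g < L h) && ((L g < L z) || [exists t, (kd t == KD) && (L g < L t < L h)]).
Proof.
have Lg0 := lab_gt0 labL 0 g; have [k Ek] : {k | lab 0 g = k.+1}.
  by exists (lab 0 g).-1; rewrite prednK.
have -> : tangled L = at_y k.
  apply/idP/idP; last exact: tangled_still_at_y.
  by apply: contraTT => /(untangled_left_y Ek).
apply/idP/andP => [/(at_y_first_B_only_if Ek)[ltgh gz_or]|[ltgh gz_or]].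
  split=> //; apply/orP; case: gz_or => [|[t kdt ltt]]; [by left | right].
  by apply/existsP; exists t; rewrite kdt.
apply: (at_y_first_B_if Ek) => //.
case/orP: gz_or => [|/existsP[t /andP[/eqP]]]; first by left.
by right; exists t.
Qed.

End Shape.

(** * Permutations and shuffles *)

Section Words.
Set Implicit Arguments.
Unset Strict Implicit.
Unset Printing Implicit Defensive.

Lemma count_flatten_map (I S : Type) (p : pred S) (F : I -> seq S) (s : seq I) :
  count p (flatten [seq F i | i <- s]) = \sum_(i <- s) count p (F i).
Proof. by rewrite count_flatten sumnE !big_map. Qed.

Lemma size_flatten_map (I S : Type) (F : I -> seq S) (s : seq I) :
  size (flatten [seq F i | i <- s]) = \sum_(i <- s) size (F i).
Proof. by rewrite size_flatten sumnE !big_map. Qed.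

(** The blocks are pairwise disjoint when a key computed from an element recovers
    the block it comes from. *)
Lemma uniq_flatten_map (I J S : eqType) (F : I -> seq S) (s : seq I)
    (key : S -> J) (tag : I -> J) :
  {in s &, injective tag} -> uniq s ->
  (forall i, i \in s -> uniq (F i)) ->
  (forall i u, i \in s -> u \in F i -> key u = tag i) ->
  uniq (flatten [seq F i | i <- s]).
Proof.
elim: s => //= i s IH inj /andP[nis us] uF keyF; rewrite cat_uniq uF ?mem_head //=.
apply/andP; split; last first.
  apply: IH => // [j k js ks|j js|j u js]; last 2 first.
  - by apply: uF; rewrite inE js orbT.
  - by apply: keyF; rewrite inE js orbT.
  by apply: inj; rewrite inE ?js ?ks orbT.
apply/hasPn => u /flatten_mapP[j js uj]; apply/negP => ui.
have jis : j \in i :: s by rewrite inE js orbT.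
have Eij : i = j.
  by apply: inj; rewrite ?mem_head // -(keyF i u) ?mem_head // (keyF j u).
by rewrite Eij js in nis.
Qed.

Section Fibre.
Variables (T K : eqType) (kd : T -> K).

(** Permutations of [s] spelling a given word: equal letters of the word can be
    filled independently, in any order, by the elements having this letter. *)
Lemma count_permutations_map (s : seq T) (w ks : seq K) :
  uniq s -> perm_eq w (map kd s) -> uniq ks -> {subset w <= ks} ->
  count (fun l => map kd l == w) (permutations s) =
  \prod_(k <- ks) (count_mem k w)`!.
Proof.
move=> + + uks; elim: w s => [|k w IH] s us pw sub.
  have /nilP -> : nilp s by rewrite /nilp -(size_map kd) -(perm_size pw).
  by rewrite big1.
have s0 : 0 < size s by rewrite -(size_map kd) -(perm_size pw).
rewrite (seq.permP (permutationsE s0)) undup_id // count_flatten_map.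
rewrite (eq_big_seq (fun x => (kd x == k) * \prod_(j <- ks) (count_mem j w)`!)).
  have kks : k \in ks by rewrite sub ?mem_head.
  rewrite -big_distrl /=.
  have -> : \sum_(x <- s) (kd x == k : nat) = (count_mem k w).+1.
    have := seq.permP pw (pred1 k); rewrite /= eqxx add1n => ->.
    by rewrite count_map -sum1_count [RHS]big_mkcond; apply: eq_bigr => x _ /=; case: eqP.
  rewrite !(bigD1_seq k kks uks) /= eqxx add1n factS mulnA; congr (_ * _).
  by apply: eq_bigr => j; rewrite eq_sym => /negPf ->.
move=> x xs /=; rewrite count_map.
case: (eqVneq (kd x) k) => [Ek|nk]; last first.
  rewrite mul0n -(count_pred0 (permutations (rem x s))).
  by apply: eq_count => l /=; rewrite eqseq_cons (negPf nk).
rewrite mul1n -(IH (rem x s)) ?rem_uniq //; last first.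
- by move=> j jw; rewrite sub // inE jw orbT.
- by rewrite -(perm_cons k) (perm_trans pw) // -{1}Ek -map_cons perm_map ?perm_to_rem.
by apply: eq_count => l /=; rewrite eqseq_cons Ek eqxx.
Qed.

Lemma count_map_mem (S R : eqType) (f : S -> R) (s : seq S) (G : seq R) :
  uniq G -> count (fun l => f l \in G) s = \sum_(w <- G) count (fun l => f l == w) s.
Proof.
move=> uG; elim: s => [|l s IH] /=; first by rewrite big1.
rewrite big_split /= -IH; congr (_ + _).
rewrite -(count_uniq_mem _ uG) -sum1_count big_mkcond.
by apply: eq_bigr => w _; rewrite /= eq_sym; case: eqP.
Qed.
End Fibre.

Section Shuffle.
Variable K : eqType.
Implicit Types (k : K) (s w : seq K).

(** The insertions of [a] copies of [k] into [s], enumerated so that each word comes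
    once when [k] is not in [s] ([uniq_shuffle]). *)
Fixpoint shuffle k a s : seq (seq K) :=
  match s with
  | [::] => [:: nseq a k]
  | h :: s' =>
    (fix shuf a := [seq h :: w | w <- shuffle k a s'] ++
      (if a is a'.+1 then [seq k :: w | w <- shuf a'] else [::])) a
  end.

Lemma shuffle_cons0 k h s : shuffle k 0 (h :: s) = [seq h :: w | w <- shuffle k 0 s].
Proof. by rewrite /= cats0. Qed.

Lemma shuffle_consS k a h s :
  shuffle k a.+1 (h :: s) =
  [seq h :: w | w <- shuffle k a.+1 s] ++ [seq k :: w | w <- shuffle k a (h :: s)].
Proof. by []. Qed.

(** The recursion of [shuffle] is Pascal's rule. *)
Lemma size_shuffle k a s : size (shuffle k a s) = 'C(a + size s, a).
Proof.
elim: s a => [|h s IHs] a; first by rewrite /= addn0 binn.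
elim: a => [|a IHa]; first by rewrite shuffle_cons0 size_map IHs !bin0.
by rewrite shuffle_consS size_cat !size_map IHs IHa /= addnS -addSnnS addSn binS addSn.
Qed.

Lemma mem_shuffle k a s w : k \notin s ->
  (w \in shuffle k a s) = (filter (predC1 k) w == s) && (count_mem k w == a).
Proof.
have nil_filter u m :
    (u == nseq m k) = (filter (predC1 k) u == [::]) && (count_mem k u == m).
  elim: u m => [|h u IHu] [|m] //=; have [->|nhk] //= := eqVneq h k.
  - by rewrite add1n andbF.
  - by rewrite eqseq_cons eqxx add1n eqSS IHu.
  - by rewrite eqseq_cons (negPf nhk).
elim: s a w => [|h s IHs] a w; first by rewrite inE nil_filter.
rewrite inE negb_or eq_sym => /andP[nhk nks]; elim: a w => [|a IHa] w.
  rewrite shuffle_cons0; apply/mapP/andP => [[u us ->]|[]].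
    by move: us; rewrite IHs //= nhk eqseq_cons eqxx (negPf nhk) add0n => /andP[-> ->].
  case: w => [|g w] //=; have [->|ngk] //= := eqVneq g k.
  rewrite eqseq_cons => /andP[/eqP-> Ew Ec]; exists w => //; by rewrite IHs ?Ew.
rewrite shuffle_consS mem_cat; apply/orP/andP => [[/mapP[u us ->]|/mapP[u us ->]]|[]].
- by move: us; rewrite IHs //= nhk eqseq_cons eqxx (negPf nhk) add0n => /andP[-> ->].
- by move: us; rewrite IHa => /andP[Ew Ec]; rewrite /= eqxx add1n eqSS Ew Ec.
case: w => [|g w] //=; have [->|ngk] /= := eqVneq g k.
  by rewrite add1n eqSS => Ew Ec; right; apply: map_f; rewrite IHa Ew.
rewrite eqseq_cons => /andP[/eqP-> Ew Ec]; left; apply: map_f.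
by rewrite IHs // Ew.
Qed.

Lemma uniq_shuffle k a s : k \notin s -> uniq (shuffle k a s).
Proof.
elim: s a => [|h s IHs] a // ; rewrite inE negb_or => /andP[nkh nks].
elim: a => [|a IHa].
  by rewrite shuffle_cons0 map_inj_uniq ?IHs // => u v [].
rewrite shuffle_consS cat_uniq !map_inj_uniq ?IHs ?IHa //; try by move=> u v [].
rewrite andbT /=; apply/hasPn => _ /mapP[u _ ->]; apply/mapP => -[v _ [E]].
by rewrite E eqxx in nkh.
Qed.
End Shuffle.
End Words.

(** * The words of blocked labelings *)

Section ShuffleMore.
Set Implicit Arguments.
Unset Strict Implicit.
Unset Printing Implicit Defensive.
Variable K : eqType.
Implicit Types (k : K) (s w : seq K).

Lemma count_shuffle j k a s w : k \notin s -> w \in shuffle k a s ->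
  count_mem j w = (j == k) * a + count_mem j s.
Proof.
move=> nks; rewrite mem_shuffle // => /andP[/eqP <- /eqP <-].
have [->|njk] := eqVneq j k.
  rewrite mul1n count_filter (@eq_count _ (predI _ _) pred0) ?count_pred0 ?addn0 // => t /=.
  by rewrite andbN.
rewrite count_filter; apply: eq_count => t /=.
by case: eqP => //= ->; rewrite njk.
Qed.

Lemma size_mem_shuffle k a s w : k \notin s -> w \in shuffle k a s ->
  size w = a + size s.
Proof.
move=> nks; rewrite mem_shuffle // => /andP[/eqP <- /eqP <-].
by rewrite size_filter count_predC.
Qed.

Lemma nseq_of_count k s : (forall j, j != k -> count_mem j s = 0) ->
  s = nseq (count_mem k s) k.
Proof.
move=> cnt; have alls : all (pred1 k) s.
  apply/allP => j js; apply: contraTT js => /cnt.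
  by move/eqP; rewrite -leqn0 leqNgt -has_count has_pred1.
by move: (alls); rewrite all_count => /eqP ->; apply/all_pred1P.
Qed.

End ShuffleMore.

Section BlockedWords.
Variables a b c d : nat.

(** The parameter [e] is the multiplicity of [KX] and [KY], which end every blocked
    word and are absent from its core. *)
Definition kind_card e k : nat :=
  match k with
  | KA => a | KB => b | KC => c | KD => d | KX | KY => e | KZ => 1
  end.

(** In a word read by increasing labels, [index KB w] and [index KC w] are the
    positions of the smallest beta and gamma labels. *)
Definition block_word (w : seq kind) :=
  [&& index KZ w < index KB w, index KB w < index KC w
    & KD \notin drop (index KB w) (take (index KC w) w)].

(** What follows the first gamma. *)
Definition tails i j :=
  flatten [seq shuffle KB i s | s <- shuffle KD j (nseq (c - 1) KC)].

(** Before the first beta there are only [KZ] and deltas; between the first beta and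
    the first gamma there are only betas. *)
Definition cores_at i j :=
  [seq u ++ nseq (b - i) KB ++ KC :: v
     | u <- shuffle KZ 1 (nseq (d - j) KD), v <- tails i j].

Definition cores :=
  flatten [seq flatten [seq cores_at i j | j <- index_iota 0 d.+1]
             | i <- index_iota 0 b].

Definition blocked_words :=
  [seq rcons (rcons u KY) KX | u <- flatten [seq shuffle KA a w | w <- cores]].

Let nD_nC j : KD \notin nseq j KC. Proof. by rewrite mem_nseq andbF. Qed.
Let nZ_nD j : KZ \notin nseq j KD. Proof. by rewrite mem_nseq andbF. Qed.

Let nB_tail j s : s \in shuffle KD j (nseq (c - 1) KC) -> KB \notin s.
Proof.
move=> /(count_shuffle KB (nD_nC _)).
by rewrite count_nseq => cB; apply/count_memPn; rewrite cB.
Qed.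

Lemma mem_tails i j v : v \in tails i j =
  [&& filter (predC1 KD) (filter (predC1 KB) v) == nseq (c - 1) KC,
      count_mem KD v == j & count_mem KB v == i].
Proof.
have cD : count_mem KD (filter (predC1 KB) v) = count_mem KD v.
  by rewrite count_filter; apply: eq_count => -[].
apply/flatten_mapP/and3P => [[s ss]|[Es ED EB]].
  rewrite mem_shuffle ?(nB_tail ss) // => /andP[/eqP Es EB].
  by move: ss; rewrite -Es mem_shuffle // cD => /andP[].
exists (filter (predC1 KB) v); first by rewrite mem_shuffle // Es cD.
by rewrite mem_shuffle ?eqxx ?EB // mem_filter.
Qed.

Lemma count_tails k i j v : v \in tails i j ->
  count_mem k v = (k == KB) * i + ((k == KD) * j + (k == KC) * (c - 1)).
Proof.
case/flatten_mapP => s ss vs; rewrite (count_shuffle _ (nB_tail ss) vs).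
by rewrite (count_shuffle _ (nD_nC _) ss) count_nseq /= [KC == k]eq_sym.
Qed.

Lemma uniq_tails i j : uniq (tails i j).
Proof.
apply: (@uniq_flatten_map _ _ _ _ _ (filter (predC1 KB)) id) => //.
- exact/uniq_shuffle/nD_nC.
- by move=> s ss; apply/uniq_shuffle/(nB_tail ss).
- by move=> s v ss; rewrite mem_shuffle ?(nB_tail ss) // => /andP[/eqP].
Qed.

Lemma size_tails i j : size (tails i j) = trinomial i j (c - 1).
Proof.
rewrite size_flatten_map (eq_big_seq (fun=> 'C(i + j + (c - 1), i))); last first.
  move=> s ss; rewrite size_shuffle.
  by rewrite (size_mem_shuffle (nD_nC _) ss) size_nseq addnA.
rewrite big_const_seq count_predT size_shuffle size_nseq iter_addn_0 /trinomial.
set r := c - 1.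
have -> : (i + j + r)`! =
    'C(i + j + r, i) * 'C(j + r, j) * (i`! * j`! * r`!).
  rewrite -(@bin_fact (i + j + r) i) -?addnA ?leq_addr // addKn.
  rewrite -(@bin_fact (j + r) j) ?leq_addr // addKn.
  by rewrite -!mulnA (mulnCA i`!).
by rewrite mulnK // !muln_gt0 !fact_gt0.
Qed.

Lemma core_partsP i j w : w \in cores_at i j ->
  exists u v, [/\ w = u ++ nseq (b - i) KB ++ KC :: v,
    u \in shuffle KZ 1 (nseq (d - j) KD) & v \in tails i j].
Proof. by case/allpairsP => -[u v] /= [uu vv ->]; exists u, v. Qed.

Lemma index_core i j u v : i < b -> u \in shuffle KZ 1 (nseq (d - j) KD) ->
  let w := u ++ nseq (b - i) KB ++ KC :: v in
  [/\ index KZ w < size u, index KB w = size u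
    & index KC w = size u + (b - i)].
Proof.
move=> ltib uu w; have cu k := count_shuffle k (nZ_nD _) uu.
have nmem k : k != KZ -> k != KD -> k \notin u.
  move=> nZ nD; apply/count_memPn; rewrite cu (negPf nZ) count_nseq /=.
  by rewrite eq_sym (negPf nD).
split.
- by rewrite /w index_cat ifT ?index_mem -?has_pred1 ?has_count ?cu.
- rewrite /w index_cat (negPf (nmem KB _ _)) //.
  by case E: (b - i) => [|m] /=; [lia | rewrite addn0].
- rewrite /w index_cat (negPf (nmem KC _ _)) // index_cat mem_nseq andbF.
  by rewrite size_nseq /= addn0.
Qed.

Lemma drop_core i j u v : i < b -> u \in shuffle KZ 1 (nseq (d - j) KD) ->
  let w := u ++ nseq (b - i) KB ++ KC :: v in drop (index KC w) w = KC :: v.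
Proof.
move=> ltib uu w; have [_ _ ->] := index_core v ltib uu.
by rewrite /w catA drop_size_cat // size_cat size_nseq.
Qed.

(** The numbers of betas and deltas after the first gamma recover [i] and [j]. *)
Lemma uniq_cores : uniq cores.
Proof.
pose key k w := count_mem k (drop (index KC w) w).
apply: (@uniq_flatten_map _ _ _ _ _ (key KB) id) => //; first exact: iota_uniq.
  move=> i; rewrite mem_index_iota leq0n andTb => ltib.
  apply: (@uniq_flatten_map _ _ _ _ _ (key KD) id) => //; first exact: iota_uniq.
    move=> j _; apply: allpairs_uniq; rewrite ?uniq_tails ?uniq_shuffle //.
    move=> [u v] [u' v'] /allpairsP[[u1 v1] /= [uu _ [-> ->]]].
    move=> /allpairsP[[u2 v2] /= [uu' _ [-> ->]]] /= /eqP.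
    rewrite eqseq_cat ?(size_mem_shuffle _ uu) ?(size_mem_shuffle _ uu') //.
    by rewrite eqseq_cat // => /and3P[/eqP-> _ /eqP[->]].
  move=> j w _ /core_partsP[u [v [-> uu vv]]].
  by rewrite /key (drop_core _ ltib uu) /= (count_tails _ vv) /= mul1n addn0.
move=> i w; rewrite mem_index_iota leq0n andTb => ltib.
case/flatten_mapP => j _ /core_partsP[u [v [-> uu vv]]].
by rewrite /key (drop_core _ ltib uu) /= (count_tails _ vv) /= mul1n addn0.
Qed.

Lemma size_cores : size cores =
  \sum_(0 <= i < b) \sum_(0 <= j < d.+1) (d - j + 1) * trinomial i j (c - 1).
Proof.
rewrite size_flatten_map; apply: eq_bigr => i _.
rewrite size_flatten_map; apply: eq_bigr => j _.
by rewrite size_allpairs size_tails size_shuffle size_nseq bin1 addnC.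
Qed.

(** A word satisfying [block_word] is cut before its first beta and around its first
    gamma; the letter counts then leave no choice in the middle part. *)
Lemma mem_cores w : 0 < c ->
  reflect ((forall k, k != KA -> k != KX -> k != KY -> count_mem k w = kind_card 0 k) /\
           (forall k, k \in [:: KA; KX; KY] -> count_mem k w = 0) /\
           block_word w)
    (w \in cores).
Proof.
move=> c0; apply: (iffP idP).
  case/flatten_mapP => i; rewrite mem_index_iota leq0n andTb => ltib.
  case/flatten_mapP => j; rewrite mem_index_iota leq0n andTb => ltjd.
  move=> /core_partsP[u [v [-> uu vv]]].
  have cu k := count_shuffle k (nZ_nD _) uu.
  have cv k := count_tails k vv.
  split; last split.
  - case=> // _ _ _; rewrite !count_cat /= cu cv !count_nseq /=; lia.
  - by case=> // _; rewrite !count_cat /= cu cv !count_nseq.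
  rewrite /block_word; have [ltZ -> ->] := index_core v ltib uu.
  rewrite ltZ -[X in X < _]addn0 ltn_add2l subn_gt0 ltib /=.
  rewrite catA take_size_cat ?size_cat ?size_nseq // drop_size_cat //.
  by rewrite mem_nseq andbF.
case=> cnt [cnt0 /and3P[ltZB ltBC nD]].
set iB := index KB w in ltZB ltBC nD; set iC := index KC w in ltBC nD.
have Cw : KC \in w by rewrite -has_pred1 has_count cnt.
have ltC : iC < size w by rewrite index_mem.
(* The equations keep the three parts opaque while letters are counted. *)
have [u Eu] : {u | u = take iB w} by eexists.
have [m Em] : {m | m = drop iB (take iC w)} by eexists.
have [v Ev] : {v | v = drop iC.+1 w} by eexists.
have Ew : w = u ++ m ++ KC :: v.
  have -> : KC :: v = drop iC w by rewrite Ev (drop_nth KX ltC) nth_index.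
  by rewrite Em Eu catA -(@take_takel _ iB iC) 1?ltnW // !cat_take_drop.
have nKu k : iB <= index k w -> k \notin u.
  by rewrite Eu => leBk; apply/negP => /index_ltn; rewrite ltnNge leBk.
have nCm : KC \notin m.
  by rewrite Em; apply/negP => /mem_drop /index_ltn; rewrite ltnn.
have nBu := nKu KB (leqnn _); have nCu := nKu KC (ltnW ltBC).
have Zu : KZ \in u by rewrite Eu in_take_leq // ltnW // (ltn_trans ltBC).
have cw k : count_mem k w = count_mem k u + (count_mem k m + ((KC == k) + count_mem k v)).
  by rewrite {1}Ew !count_cat.
have cZu : 0 < count_mem KZ u by rewrite -has_count has_pred1.
have c0u k : k \notin u -> count_mem k u = 0 by move/count_memPn.
have nDm : count_mem KD m = 0 by apply/count_memPn; rewrite Em.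
have cCm : count_mem KC m = 0 by apply/count_memPn.
have zero k : k \in [:: KA; KX; KY] ->
    [/\ count_mem k u = 0, count_mem k m = 0 & count_mem k v = 0].
  move=> k0; move/eqP: (cnt0 k k0); rewrite cw !addn_eq0.
  by case/and4P=> [/eqP-> /eqP-> _ /eqP->].
have [[Au Am Av] [Xu Xm Xv] [Yu Ym Yv]] := And3 (zero KA isT) (zero KX isT) (zero KY isT).
have [Zm Zv Zu1] : [/\ count_mem KZ m = 0, count_mem KZ v = 0 & count_mem KZ u = 1].
  have : 1 = count_mem KZ u + (count_mem KZ m + (0 + count_mem KZ v)).
    by rewrite -(cw KZ) cnt.
  by move: cZu; clear; move=> c1 c2; split; lia.
have cB : b = count_mem KB m + count_mem KB v.
  by have := cw KB; rewrite cnt // c0u.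
have cC : c = (count_mem KC v).+1.
  by have := cw KC; rewrite cnt // c0u // cCm.
have cD : d = count_mem KD u + count_mem KD v.
  by have := cw KD; rewrite cnt // nDm.
have Emm : m = nseq (count_mem KB m) KB by apply: nseq_of_count => -[].
have m0 : 0 < count_mem KB m.
  have : 0 < size m by rewrite Em size_drop size_take ltC subn_gt0.
  by rewrite {1}Emm size_nseq.
apply/flatten_mapP; exists (count_mem KB v).
  by rewrite mem_index_iota leq0n cB -[X in X < _]add0n ltn_add2r.
apply/flatten_mapP; exists (count_mem KD v).
  by rewrite mem_index_iota leq0n ltnS cD leq_addl.
rewrite Ew; apply/allpairsP; exists (u, v); split=> /=.
- rewrite mem_shuffle // Zu1 eqxx andbT cD addnK.
  have cf k : k != KZ -> count_mem k (filter (predC1 KZ) u) = count_mem k u.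
    by move=> nk; rewrite count_filter; apply: eq_count => t /=; case: eqP => //= ->.
  rewrite -(cf KD) //; apply/eqP/nseq_of_count => k nk.
  have [->|nZ] := eqVneq k KZ.
    by apply/count_memPn; rewrite mem_filter.
  by rewrite cf //; case: k nk nZ => // _ _; rewrite c0u.
- rewrite mem_tails !eqxx !andbT cC subn1 /=.
  have cf k : k \notin [:: KB; KD] ->
      count_mem k (filter (predC1 KD) (filter (predC1 KB) v)) = count_mem k v.
    move=> nk; rewrite !count_filter; apply: eq_count => t /=.
    by case: eqP => //= ->; case: (k) nk.
  rewrite -(cf KC) //; apply/eqP/nseq_of_count => k nk.
  have [kk|kk] := boolP (k \in [:: KB; KD]).
    by apply/count_memPn; rewrite !mem_filter; case: (k) kk.
  by rewrite cf //; case: k nk kk.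
- by rewrite {1}Emm {1}cB addnK.
Qed.

Lemma size_kinds w : size w =
  count_mem KA w + count_mem KB w + count_mem KC w + count_mem KD w +
  count_mem KX w + count_mem KY w + count_mem KZ w.
Proof. by elim: w => //= k w ->; case: k => /=; lia. Qed.

Lemma size_mem_cores w : 0 < c -> w \in cores -> size w = b + c + d + 1.
Proof.
move=> c0 /(mem_cores _ c0)[cnt [cnt0 _]].
rewrite size_kinds (cnt KB) // (cnt KC) // (cnt KD) // (cnt KZ) //.
by rewrite !cnt0 // add0n !addn0.
Qed.

Lemma nA_cores w : 0 < c -> w \in cores -> KA \notin w.
Proof. by move=> c0 /(mem_cores _ c0)[_ [cnt0 _]]; apply/count_memPn/cnt0. Qed.

Lemma size_blocked_words : 0 < c -> size blocked_words =
  'C(a + b + c + d + 1, a) *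
  \sum_(0 <= i < b) \sum_(0 <= j < d.+1) (d - j + 1) * trinomial i j (c - 1).
Proof.
move=> c0; rewrite size_map size_flatten_map -size_cores.
rewrite (eq_big_seq (fun=> 'C(a + b + c + d + 1, a))).
  by rewrite big_const_seq count_predT iter_addn_0.
by move=> w ww; rewrite size_shuffle (size_mem_cores c0 ww) !addnA.
Qed.

Lemma uniq_blocked_words : 0 < c -> uniq blocked_words.
Proof.
move=> c0; rewrite map_inj_uniq => [|u v /rcons_inj[/rcons_inj[]] //].
apply: (@uniq_flatten_map _ _ _ _ _ (filter (predC1 KA)) id) => //.
- exact: uniq_cores.
- by move=> w ww; apply/uniq_shuffle/nA_cores.
- by move=> w u ww; rewrite mem_shuffle ?nA_cores // => /andP[/eqP].
Qed.

Lemma mem_blocked_words u p q : 0 < c ->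
  (forall k, k \in [:: KA; KB; KC; KD; KZ] -> p = KY -> q = KX ->
     count_mem k u = kind_card 0 k) ->
  (p = KY -> q = KX -> (KX \notin u) && (KY \notin u)) ->
  (rcons (rcons u p) q \in blocked_words) =
  [&& q == KX, p == KY & block_word (filter (predC1 KA) u)].
Proof.
move=> c0 cnt nXY; apply/mapP/and3P => [[v vv /rcons_inj[/rcons_inj[-> ->] ->]]|].
  split=> //; case/flatten_mapP: vv => w ww.
  rewrite mem_shuffle ?nA_cores // => /andP[/eqP -> _].
  by have [_ []] := mem_cores _ c0 ww.
case=> /eqP Eq /eqP Ep blk; exists u; last by rewrite Eq Ep.
apply/flatten_mapP; exists (filter (predC1 KA) u); last first.
  by rewrite mem_shuffle ?mem_filter // cnt // !eqxx.
have /andP[nX nY] := nXY Ep Eq.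
have cf k : k != KA -> count_mem k (filter (predC1 KA) u) = count_mem k u.
  by move=> nk; rewrite count_filter; apply: eq_count => t /=; case: eqP => //= ->.
apply/(mem_cores _ c0); split=> [k nA nX' nY'|].
  by rewrite cf // cnt //; case: (k) nA nX' nY'.
split=> // k; rewrite !inE => kAXY; apply/count_memPn; move: kAXY.
by case/or3P => /eqP->; rewrite mem_filter ?(negPf nX) ?(negPf nY).
Qed.

Lemma count_blocked_words w k : 0 < c -> w \in blocked_words ->
  count_mem k w = kind_card 1 k.
Proof.
move=> c0 /mapP[u /flatten_mapP[v vv uv] ->].
have [cnt [cnt0 _]] := mem_cores _ c0 vv.
rewrite -!cats1 !count_cat (count_shuffle _ (nA_cores c0 vv) uv) /=.
case: k; rewrite ?(cnt0 KA) ?(cnt0 KX) ?(cnt0 KY) ?(cnt KB) ?(cnt KC) ?(cnt KD)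
  ?(cnt KZ) //= ?mul1n ?addn0 //.
Qed.

End BlockedWords.

(** * Labelings as permutations *)

Section LastTwo.
Set Implicit Arguments.
Unset Strict Implicit.
Unset Printing Implicit Defensive.
Variable T : eqType.
Implicit Types (l : seq T) (p q t : T).

Lemma index_last l q t : uniq (rcons l q) -> t \in rcons l q ->
  (index t (rcons l q) == size l) = (q == t).
Proof.
rewrite rcons_uniq mem_rcons inE -cats1 index_cat => /andP[nql ul].
have [<-|nqt] := eqVneq q t; first by rewrite (negPf nql) /= eqxx addn0 eqxx.
by move=> /= tl; rewrite tl ltn_eqF // index_mem.
Qed.

Lemma index_penultimate l p q t : uniq (rcons (rcons l p) q) ->
  t \in rcons (rcons l p) q ->
  (index t (rcons (rcons l p) q) == size l) = (p == t).
Proof.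
move=> ul; rewrite mem_rcons inE => /orP[/eqP->|tl].
  have := @index_last (rcons l p) q q ul; rewrite mem_rcons mem_head eqxx => /(_ isT)/eqP ->.
  rewrite size_rcons gtn_eqF //; apply/esym/negbTE.
  by move: ul; rewrite rcons_uniq mem_rcons inE negb_or eq_sym => /andP[/andP[]].
rewrite -[rcons (rcons l p) q]cats1 index_cat tl index_last //.
by move: ul; rewrite rcons_uniq => /andP[].
Qed.

Lemma index_filter (P : pred T) l t t' : P t -> P t' -> t \in l -> t' \in l ->
  (index t (filter P l) < index t' (filter P l)) = (index t l < index t' l).
Proof.
move=> Pt Pt'; elim: l => //= h l IH; rewrite !inE.
case: (boolP (P h)) => [Ph|nPh] /=.
  by case: (eqVneq t h) => [->|nth]; case: (eqVneq t' h) => [->|nth'] //=;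
    rewrite ?eqxx //= ltnS; apply: IH.
have nh s : P s -> (s == h) = false by case: eqP => // -> /idP; rewrite (negPf nPh).
by rewrite ![h == _]eq_sym !nh //= ltnS; apply: IH.
Qed.

End LastTwo.

Section Count.
Set Implicit Arguments.
Unset Strict Implicit.
Unset Printing Implicit Defensive.
Context {disp : Order.disp_t} {T : finPOrderType disp}.
Local Notation perms := (permutations (enum T)).
Implicit Types (l : seq T) (t p q : T).

Definition labeling_of l : {ffun T -> 'I_#|T|.+1} :=
  [ffun t => inord (index t l).+1].

Lemma permsP l : l \in perms -> [/\ uniq l, size l = #|T| & forall t, t \in l].
Proof.
rewrite mem_permutations => pl; split=> [||t].
- by rewrite (perm_uniq pl) enum_uniq.
- by rewrite (perm_size pl) -cardT.
- by rewrite (perm_mem pl) mem_enum.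
Qed.

Lemma labeling_ofE l t : l \in perms -> labeling_of l t = (index t l).+1 :> nat.
Proof.
case/permsP => _ sl allT; rewrite ffunE inordK // ltnS -sl.
by rewrite index_mem.
Qed.

Lemma labeling_of_labeling l : l \in perms -> is_labeling (labeling_of l).
Proof.
move=> pl; have [ul sl allT] := permsP pl.
apply/labelingP; split=> [u v|t]; rewrite !labeling_ofE // => -[].
exact: index_inj.
Qed.

Lemma labeling_of_inj : {in perms &, injective labeling_of}.
Proof.
move=> l l' pl pl' El; have [ul sl _] := permsP pl; have [_ sl' al'] := permsP pl'.
case: (pickP T) => [x0 _|T0]; last first.
  by case: l sl {pl El ul} => [|t l];
    [case: l' sl' {pl' al'} => // t; have := T0 t | have := T0 t].
apply: (@eq_from_nth _ x0); rewrite ?sl // => i lti.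
have Ei : index (nth x0 l i) l' = i.
  by have := congr1 (fun L : {ffun T -> 'I_#|T|.+1} => L (nth x0 l i) : nat) El;
    rewrite !labeling_ofE // index_uniq ?sl // => -[].
by rewrite -{2}Ei nth_index.
Qed.

Lemma labeling_of_onto L : is_labeling L -> exists2 l, l \in perms & L = labeling_of l.
Proof.
move=> labL.
have [|f' fK f'K] := inj_card_bij (@labeling_index_inj _ _ L labL).
  by rewrite card_ord.
have pl : [seq f' i | i <- enum 'I_#|T|] \in perms.
  rewrite mem_permutations uniq_perm ?enum_uniq // => [|t].
    by rewrite map_inj_uniq ?enum_uniq //; apply: can_inj f'K.
  by rewrite mem_enum -[t]fK map_f // mem_enum.
exists [seq f' i | i <- enum 'I_#|T|] => //.
apply/ffunP => t; apply: ord_inj; rewrite labeling_ofE //.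
rewrite -{2}[t]fK index_map; last exact: can_inj f'K.
by rewrite index_enum_ord /= prednK ?labeling_gt0.
Qed.

Lemma card_labelings (P : pred {ffun T -> 'I_#|T|.+1}) :
  #|[set L | is_labeling L && P L]| = count (fun l => P (labeling_of l)) perms.
Proof.
rewrite -size_filter -(size_map labeling_of).
set s := map _ _; have us : uniq s.
  rewrite map_inj_in_uniq ?filter_uniq ?permutations_uniq // => l l'.
  by rewrite !mem_filter => /andP[_ pl] /andP[_ pl']; apply: labeling_of_inj.
rewrite -(card_uniqP us); apply: eq_card => L; rewrite inE.
apply/andP/mapP => [[labL PL]|[l]].
  have [l pl EL] := labeling_of_onto labL.
  by exists l => //; rewrite mem_filter -EL PL.
by rewrite mem_filter => /andP[Pl pl] ->; split=> //; apply: labeling_of_labeling.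
Qed.

Variable m : nat.
Hypothesis cardT2 : #|T| = m.+2.

Lemma perms_last_two l : l \in perms ->
  exists l0 p q, l = rcons (rcons l0 p) q /\ size l0 = m.
Proof.
case/permsP => _ + _; rewrite cardT2.
case/lastP: l => // l q; rewrite size_rcons => -[].
by case/lastP: l => // l p; rewrite size_rcons => -[sl]; exists l, p, q.
Qed.

Lemma labeling_last l p q t : rcons (rcons l p) q \in perms ->
  (labeling_of (rcons (rcons l p) q) t == #|T| :> nat) = (q == t).
Proof.
move=> pl; have [ul sl allT] := permsP pl.
by rewrite labeling_ofE // -sl size_rcons eqSS index_last.
Qed.

Lemma labeling_penultimate l p q t : rcons (rcons l p) q \in perms ->
  (labeling_of (rcons (rcons l p) q) t == #|T|.-1 :> nat) = (p == t).
Proof.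
move=> pl; have [ul sl allT] := permsP pl.
by rewrite labeling_ofE // -sl !size_rcons eqSS index_penultimate.
Qed.

(** An instance of [count_permutations_map]: the word is constant except for its
    last two letters. *)
Lemma card_labelings_last_two (x p : T) : x != p ->
  #|[set L : {ffun T -> 'I_#|T|.+1} | is_labeling L &&
      ((L x == #|T| :> nat) && (L p == #|T|.-1 :> nat))]| = m`!.
Proof.
move=> nxp; rewrite card_labelings.
pose kd t : nat := if t == x then 2 else (t == p).
pose w := rcons (rcons (nseq m 0) 1) 2.
have kd2 t : (kd t == 2) = (t == x).
  by rewrite /kd; case: (t =P x) => // _; case: (t == p).
have kd1 t : (kd t == 1) = (t == p).
  by rewrite /kd; case: (t =P x) => [->|_]; [rewrite (negPf nxp) | case: (t == p)].
have kdw l0 : rcons (rcons l0 p) x \in perms -> map kd (rcons (rcons l0 p) x) = w.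
  case/permsP; rewrite !rcons_uniq mem_rcons inE !size_rcons cardT2.
  case/and3P => /norP[_ nx] np _ [sl] _; rewrite !map_rcons /w.
  rewrite /kd eqxx (eq_sym p) (negPf nxp) eqxx; congr (rcons (rcons _ _) _).
  rewrite -sl -[in RHS](size_map kd); apply/all_pred1P/allP => _ /mapP[t tl ->].
  have ntx : t != x by apply: contraNneq nx => <-.
  have ntp : t != p by apply: contraNneq np => <-.
  by rewrite /= /kd (negPf ntx) (negPf ntp).
rewrite (eq_in_count (a2 := fun l => map kd l == w)) => [|l pl]; last first.
  have [l0 [p' [q' [El sl]]]] := perms_last_two pl; rewrite El in pl *.
  rewrite labeling_last // labeling_penultimate //.
  apply/andP/eqP => [[/eqP Eq /eqP Ep]|]; first by rewrite Eq Ep in pl *; apply: kdw.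
  rewrite /w !map_rcons => /rcons_inj[/rcons_inj[_ /eqP]]; rewrite kd1 => -> /eqP.
  by rewrite kd2.
rewrite (@count_permutations_map _ _ kd _ w [:: 0; 1; 2]) ?enum_uniq //.
- rewrite !big_cons big_nil /w -!cats1 !count_cat !count_nseq /=.
  by rewrite mul1n !mul0n !addn0 !add0n !muln1.
- pose l0 := filter (predC (pred2 p x)) (enum T).
  have ml0 t : t \in l0 = (t != p) && (t != x).
    by rewrite mem_filter mem_enum andbT /= negb_or.
  have pl : rcons (rcons l0 p) x \in perms.
    rewrite mem_permutations; apply: uniq_perm => [||t]; rewrite ?enum_uniq //.
      rewrite !rcons_uniq mem_rcons !inE !ml0 !eqxx andbF (negPf nxp).
      by rewrite filter_uniq ?enum_uniq.
    by rewrite [RHS]mem_enum mem_rcons inE mem_rcons inE ml0; case: (t =P x); case: (t =P p).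
  by rewrite -(kdw l0 pl) perm_map // -mem_permutations.
- move=> k; rewrite /w mem_rcons inE mem_rcons inE mem_nseq.
  by case/or3P => [/eqP->|/eqP->|/andP[_ /eqP->]].
Qed.

End Count.

(** * Counting blocked labelings *)

Section Blocked.
Set Implicit Arguments.
Unset Strict Implicit.
Unset Printing Implicit Defensive.
Context {disp : Order.disp_t} {T : finPOrderType disp}.
Variables (kd : T -> kind) (x y z : T).
Implicit Types (L : {ffun T -> 'I_#|T|.+1}) (l : seq T) (t p q g h : T).
Local Notation perms := (permutations (enum T)).

(** When [L x = n] and [L y = n-1], this is how a labeling whose betas come first
    can fail to be tangled ([tangled_Y]). *)
Definition blocked L :=
  [exists g, [exists h, [&& first_of kd L KB g, first_of kd L KC h, L z < L g,
     L g < L h & [forall t, (kd t == KD) ==> ~~ (L g < L t < L h)]]]].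

Definition before k k' L :=
  [exists g, (kd g == k) && [forall h, (kd h == k') ==> (L g < L h)]].

Lemma first_of_exists L k g0 : kd g0 = k -> exists g, first_of kd L k g.
Proof.
move=> /eqP kg0.
have [g kg ming] := @arg_minnP _ g0 (fun g => kd g == k) (fun g => L g : nat) kg0.
by exists g; rewrite /first_of kg; apply/forallP => h; apply/implyP/ming.
Qed.

Lemma first_of_inj L k g g' : is_labeling L ->
  first_of kd L k g -> first_of kd L k g' -> g = g'.
Proof.
move=> labL /andP[kg /forallP ming] /andP[kg' /forallP ming'].
apply: (labeling_inj labL); apply/eqP; rewrite eqn_leq.
by rewrite (implyP (ming g') kg') (implyP (ming' g) kg).
Qed.

Lemma first_ofE L g h : is_labeling L -> first_of kd L KB g -> first_of kd L KC h ->
  blocked L = [&& L z < L g, L g < L h & [forall t, (kd t == KD) ==> ~~ (L g < L t < L h)]].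
Proof.
move=> labL fg fh; apply/existsP/idP => [[g' /existsP[h' /and3P[fg' fh' blk]]]|blk].
  by rewrite (first_of_inj labL fg fg') (first_of_inj labL fh fh').
by exists g; apply/existsP; exists h; rewrite fg fh.
Qed.

Lemma beforeE L k k' g h : first_of kd L k g -> first_of kd L k' h ->
  before k k' L = (L g < L h).
Proof.
move=> /andP[kg /forallP ming] /andP[kh /forallP minh].
apply/existsP/idP => [[g' /andP[kg' /forallP/(_ h)]]|ltgh].
  by rewrite kh; apply: leq_ltn_trans; apply: (implyP (ming g')).
exists g; rewrite kg; apply/forallP => h'; apply/implyP => kh'.
exact: leq_trans ltgh (implyP (minh h') kh').
Qed.

Section Word.
Variables (L : {ffun T -> 'I_#|T|.+1}) (l : seq T).
Hypothesis labL : is_labeling L.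
Hypothesis ul : uniq l.
Hypothesis kd_z : forall t, (kd t == KZ) = (t == z).
Hypothesis ordL : {in l &, forall t t', (L t < L t') = (index t l < index t' l)}.
Hypothesis mem_l : forall t, kd t \in [:: KB; KC; KD; KZ] -> t \in l.

Lemma index_kind_le k t : t \in l -> kd t = k -> index k (map kd l) <= index t l.
Proof.
move=> tl kt; rewrite leqNgt; apply/negP; rewrite /index find_map => /(before_find t).
by rewrite /= nth_index // kt eqxx.
Qed.

Lemma first_ofP k g : k \in [:: KB; KC; KD; KZ] ->
  first_of kd L k g = (kd g == k) && (index g l == index k (map kd l)).
Proof.
move=> kk; rewrite /first_of; case: eqP => //= kg.
have gl : g \in l by apply: mem_l; rewrite kg.
apply/forallP/eqP => [ming|Eg h]; last first.
  apply/implyP => /eqP kh; have hl : h \in l by apply: mem_l; rewrite kh.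
  by rewrite leqNgt ordL // Eg -leqNgt index_kind_le.
apply/eqP; rewrite eqn_leq index_kind_le // andbT.
have lti : index k (map kd l) < size l.
  by rewrite -(size_map kd) index_mem -kg map_f.
set g0 := nth g l (index k (map kd l)).
have kg0 : kd g0 == k.
  by rewrite /g0 -(nth_map g k kd) // nth_index // -kg map_f.
have g0l : g0 \in l by apply: mem_nth.
rewrite -(index_uniq g lti ul) -/g0 leqNgt -ordL // -leqNgt.
exact: implyP (ming g0) kg0.
Qed.

(** Membership in [l] is required for the kinds compared by [blocked] only, so that
    [l] may omit the alphas, [x] and [y]. *)
Lemma blockedE : (exists g, kd g = KB) -> (exists h, kd h = KC) ->
  blocked L = block_word (map kd l).
Proof.
move=> [g0 kg0] [h0 kh0].
have [g fg] := first_of_exists L kg0; have [h fh] := first_of_exists L kh0.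
rewrite (first_ofE labL fg fh).
move: (fg) (fh); rewrite !first_ofP // => /andP[/eqP kg /eqP Eg] /andP[/eqP kh /eqP Eh].
have kz : kd z == KZ by rewrite kd_z.
have : first_of kd L KZ z.
  by rewrite /first_of kz; apply/forallP => t; apply/implyP; rewrite kd_z => /eqP->.
rewrite first_ofP // => /andP[_ /eqP Ez].
have [gl hl zl] : [/\ g \in l, h \in l & z \in l].
  by split; apply: mem_l; rewrite ?kg ?kh ?(eqP kz).
rewrite /block_word -Ez -Eg -Eh !ordL //.
congr [&& _, _ & _]; apply/forallP/negP => [nD|nD t].
  case/(nthP KX) => i; rewrite size_drop size_take size_map index_mem hl => lti.
  have lti' : index g l + i < index h l by rewrite -ltn_subRL.
  have lts : index g l + i < size l by apply: leq_trans lti' (index_size _ _).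
  rewrite nth_drop nth_take // (nth_map g) // => kt.
  have /implyP := nD (nth g l (index g l + i)); rewrite kt => /(_ isT).
  rewrite !ordL ?mem_nth // index_uniq // lti' andbT -leqNgt -[X in _ <= X]addn0.
  rewrite leq_add2l leqn0 => /eqP i0; move: kt.
  by rewrite i0 addn0 nth_index // kg.
apply/implyP => /eqP kt; have tl : t \in l by apply: mem_l; rewrite kt.
rewrite !ordL //; apply/negP => /andP[ltgt ltth]; apply: nD.
apply/(nthP KX); exists (index t l - index g l).
  rewrite size_drop size_take size_map index_mem hl ltn_sub2r //.
  exact: ltn_trans ltth.
rewrite nth_drop subnKC 1?ltnW // nth_take // (nth_map t) ?index_mem //.
by rewrite nth_index.
Qed.

End Word.

Variables a b c d m : nat.
Hypothesis WT : W_shaped kd x y z.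
Hypothesis cardT2 : #|T| = m.+2.
Hypothesis kd_card : forall k, count_mem k (map kd (enum T)) = kind_card a b c d 1 k.
Hypotheses (b0 : 0 < b) (c0 : 0 < c).

Lemma kind_exists k : 0 < kind_card a b c d 1 k -> exists t, kd t = k.
Proof.
by rewrite -kd_card -has_count has_pred1 => /mapP[t _ ->]; exists t.
Qed.

Lemma blocked_wordE l : l \in perms ->
  [&& labeling_of l x == #|T| :> nat, labeling_of l y == #|T|.-1 :> nat
    & blocked (labeling_of l)] = (map kd l \in blocked_words a b c d).
Proof.
move=> pl; have [l0 [p [q [El sl]]]] := perms_last_two cardT2 pl.
have labL := labeling_of_labeling pl.
have [ul _ allT] := permsP pl.
have cnt k : count_mem k (map kd l) = kind_card a b c d 1 k.
  by rewrite -kd_card; apply/seq.permP/perm_map; rewrite -mem_permutations.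
rewrite El in pl labL ul allT cnt *.
rewrite (labeling_last _ pl) (labeling_penultimate _ pl) !map_rcons.
have cntu k : count_mem k (map kd l0) + (kd p == k) + (kd q == k) = kind_card a b c d 1 k.
  by rewrite -cnt !map_rcons -!cats1 !count_cat /= !addn0.
rewrite mem_blocked_words //; last 2 first.
- by move=> k kk Ep Eq; have := cntu k; rewrite Ep Eq; case: (k) kk => //= _; rewrite !addn0.
- move=> Ep Eq; apply/andP; split; apply/count_memPn.
    by have := cntu KX; rewrite Ep Eq /= addn0 addn1 => -[].
  by have := cntu KY; rewrite Ep Eq /= addn0 addn1 => -[].
rewrite (shape_x WT) (shape_y WT).
case: eqP => //= Eq; case: eqP => //= Ep.
rewrite filter_map; set l1 := filter _ l0.
have ul0 : uniq l0 by move: ul; rewrite !rcons_uniq => /and3P[].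
have ml0 t : kd t != KX -> kd t != KY -> t \in l0.
  rewrite (shape_x WT) (shape_y WT) => /negPf nx /negPf ny; have := allT t.
  by rewrite mem_rcons inE mem_rcons inE Eq Ep nx ny.
have il0 t : t \in l0 -> index t (rcons (rcons l0 p) q) = index t l0.
  by move=> tl; rewrite -!cats1 -catA index_cat tl.
apply: blockedE; rewrite ?filter_uniq //.
- exact: (shape_z WT).
- move=> t t'; rewrite !mem_filter => /andP[nt tl] /andP[nt' tl'].
  by rewrite !labeling_ofE // ltnS !il0 // index_filter.
- by move=> t kt; rewrite mem_filter ml0 /=; case: (kd t) kt.
- exact: kind_exists.
- exact: kind_exists.
Qed.

Lemma card_blocked :
  #|[set L : {ffun T -> 'I_#|T|.+1} | is_labeling L &&
     [&& L x == #|T| :> nat, L y == #|T|.-1 :> nat & blocked L]]| =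
  a`! * b`! * c`! * d`! * size (blocked_words a b c d).
Proof.
rewrite card_labelings.
rewrite (eq_in_count (a2 := fun l => map kd l \in blocked_words a b c d)); last first.
  by move=> l pl; rewrite /= blocked_wordE.
rewrite count_map_mem ?uniq_blocked_words //.
rewrite (eq_big_seq (fun=> a`! * b`! * c`! * d`!)).
  by rewrite big_const_seq count_predT iter_addn_0.
move=> w ww; have cw k := count_blocked_words k c0 ww.
rewrite (count_permutations_map (ks := [:: KA; KB; KC; KD; KX; KY; KZ])) ?enum_uniq //.
- by rewrite !big_cons big_nil !cw /= !muln1 !mulnA.
- by apply/allP => k _ /=; rewrite cw -kd_card.
- by case.
Qed.

End Blocked.

(** * Adding up the two minimal elements *)

Section Half.
Set Implicit Arguments.
Unset Strict Implicit.
Unset Printing Implicit Defensive.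
Context {disp : Order.disp_t} {T : finPOrderType disp}.
Implicit Types (L : {ffun T -> 'I_#|T|.+1}) (t p q g h : T).

Definition count_labelings (P : pred {ffun T -> 'I_#|T|.+1}) :=
  #|[set L | is_labeling L && P L]|.

Lemma count_labelings_sum P : count_labelings P = \sum_(L | is_labeling L) P L.
Proof.
rewrite /count_labelings -sum1dep_card big_mkcondr.
by apply: eq_bigr => L _; case: (P L).
Qed.

Variables (kd : T -> kind) (x y z : T) (a b c d m : nat).
Hypothesis WT : W_shaped kd x y z.
Hypothesis cardT2 : #|T| = m.+2.
Hypothesis kd_card : forall k, count_mem k (map kd (enum T)) = kind_card a b c d 1 k.
Hypotheses (b0 : 0 < b) (c0 : 0 < c).

Let kdx : kd x = KX. Proof. by apply/eqP; rewrite (shape_x WT). Qed.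
Let kdy : kd y = KY. Proof. by apply/eqP; rewrite (shape_y WT). Qed.
Let kdz : kd z = KZ. Proof. by apply/eqP; rewrite (shape_z WT). Qed.

Lemma first_B_C L : exists g h, first_of kd L KB g /\ first_of kd L KC h.
Proof.
have [|g0 kg0] := kind_exists kd_card (k := KB); first by [].
have [|h0 kh0] := kind_exists kd_card (k := KC); first by [].
have [g fg] := first_of_exists L kg0; have [h fh] := first_of_exists L kh0.
by exists g, h.
Qed.

(** Both sides only depend on the element [p] that has label [n-1]: the sum over
    alphas and betas detects whether [p] is one of them, and the two remaining
    terms differ when [p = y], where [tangled_Y] applies. *)
Lemma tangled_split L : is_labeling L -> L x = #|T| :> nat ->
  tangled L + ((L y == #|T|.-1 :> nat) && blocked kd z L) =
  \sum_(p | kd p \in [:: KA; KB]) (L p == #|T|.-1 :> nat) +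
  ((L y == #|T|.-1 :> nat) && before kd KB KC L).
Proof.
move=> labL Lx; have Lx' : label_at L 0 x = m.+2 by rewrite -cardT2.
have [|p Lp] := @labeling_onto _ _ L m.+1 labL; first by rewrite cardT2 /=.
have Lp' : label_at L 0 p = m.+1 by [].
have -> : #|T|.-1 = m.+1 by rewrite cardT2.
have Lpt t : (L t == m.+1 :> nat) = (t == p).
  by apply/eqP/eqP => [Lt|->//]; apply: (labeling_inj labL); rewrite Lt.
have -> : \sum_(p | kd p \in [:: KA; KB]) (L p == m.+1 :> nat) = (kd p \in [:: KA; KB]).
  under eq_bigr => t _ do rewrite Lpt.
  case: (boolP (kd p \in _)) => kp.
    by rewrite (bigD1 p kp) /= eqxx big1 // => t /andP[_ /negPf->].
  by rewrite big1 // => t kt; case: eqP => // E; rewrite -E kt in kp.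
rewrite Lpt [y == p]eq_sym -(shape_y WT).
have [kp|nkp] := boolP (kd p \in [:: KA; KB]).
  by rewrite (tangled_AB WT labL cardT2 Lx' Lp' kp); case: (kd p) kp.
have [kp|nkp'] := boolP (kd p \in [:: KC; KD; KZ]).
  rewrite (negbTE (untangled_CDZ WT labL cardT2 Lx' Lp' kp)).
  by case: (kd p) kp.
have npx : p != x.
  by apply: contra_eq_neq Lp => ->; rewrite Lx cardT2 gtn_eqF.
have Ep : kd p = KY.
  by move: npx nkp nkp'; rewrite -(shape_x WT); case: (kd p).
rewrite Ep eqxx add0n !andTb.
have /eqP Epy : p == y by rewrite -(shape_y WT) Ep.
have Ly' : label_at L 0 y = m.+1 by rewrite -Epy.
have [g [h [fg fh]]] := first_B_C L.
rewrite (tangled_Y WT labL cardT2 Lx' Ly' fg fh).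
rewrite (first_ofE z labL fg fh) (beforeE fg fh).
have Lgz : L g != L z :> nat.
  apply/eqP => /(labeling_inj labL) E; case/andP: fg => /eqP.
  by rewrite E kdz.
have -> : [forall t, (kd t == KD) ==> ~~ (L g < L t < L h)] =
    ~~ [exists t, (kd t == KD) && (L g < L t < L h)].
  by rewrite negb_exists; apply: eq_forallb => t; case: (kd t == KD).
have -> : (L g < L z) = ~~ (L z < L g) by rewrite -leqNgt [RHS]leq_eqVlt (negPf Lgz).
by case: [exists t, _]; case: (L g < L h); case: (L z < L g).
Qed.

(** The sum of [tangled_split] over the labelings with [L x = n]. *)
Lemma count_tangled_x :
  count_labelings (fun L => (L x == #|T| :> nat) && tangled L) +
  a`! * b`! * c`! * d`! * size (blocked_words a b c d) =
  (a + b) * m`! +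
  count_labelings (fun L =>
    [&& L x == #|T| :> nat, L y == #|T|.-1 :> nat & before kd KB KC L]).
Proof.
have -> : a`! * b`! * c`! * d`! * size (blocked_words a b c d) =
    count_labelings (fun L =>
      [&& L x == #|T| :> nat, L y == #|T|.-1 :> nat & blocked kd z L]).
  by rewrite -(card_blocked WT cardT2 kd_card).
have -> : (a + b) * m`! = \sum_(p | kd p \in [:: KA; KB])
    count_labelings (fun L => (L x == #|T| :> nat) && (L p == #|T|.-1 :> nat)).
  rewrite (eq_bigr (fun=> m`!)) => [|p kp]; last first.
    by apply: card_labelings_last_two => //; apply: contraTneq kp => <-; rewrite kdx.
  rewrite big_const_seq iter_addn_0 mulnC; congr (_ * _).
  have cnt P : count P (enum T) = count P (index_enum T).
    apply/seq.permP/uniq_perm => [||t]; rewrite ?index_enum_uniq ?enum_uniq //.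
    by rewrite mem_index_enum mem_enum.
  have <- : count (fun t => kd t == KA) (index_enum T) = a.
    by have := kd_card KA; rewrite count_map cnt.
  have <- : count (fun t => kd t == KB) (index_enum T) = b.
    by have := kd_card KB; rewrite count_map cnt.
  rewrite -count_predUI [X in _ + X](eq_count (a2 := pred0)) => [|t /=]; last first.
    by case: (kd t).
  by rewrite count_pred0 addn0; apply: eq_count => t /=; rewrite !inE.
rewrite !count_labelings_sum -!big_split /=.
under [X in _ = X + _]eq_bigr do rewrite count_labelings_sum.
rewrite exchange_big -big_split /=; apply: eq_bigr => L labL.
case: eqP => [Lx|_] /=; last by rewrite big1.
exact: tangled_split.
Qed.

End Half.

Section Mirror.
Set Implicit Arguments.
Unset Strict Implicit.
Unset Printing Implicit Defensive.

(** The symmetry of the W-poset that exchanges [x] and [z]. *)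
Definition mirror k :=
  match k with
  | KA => KD | KB => KC | KC => KB | KD => KA | KX => KZ | KY => KY | KZ => KX
  end.

Lemma mirrorK : involutive mirror.
Proof. by case. Qed.

Lemma mirror_eq k k' : (mirror k == k') = (k == mirror k').
Proof. by rewrite -(inj_eq (inv_inj mirrorK)) mirrorK. Qed.

Context {disp : Order.disp_t} {T : finPOrderType disp}.
Variables (kd : T -> kind) (x y z : T).
Hypothesis WT : W_shaped kd x y z.

Lemma W_shaped_mirror : W_shaped (mirror \o kd) z y x.
Proof.
split=> [t|t|t|u v /(shape_lt WT)|u v] /=; rewrite ?mirror_eq.
- exact: shape_z WT t.
- exact: shape_y WT t.
- exact: shape_x WT t.
- by case: (kd u); case: (kd v).
by rewrite mirrorK => lt_uv neq_uv; apply: (shape_kind_lt WT) => //;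
  case: (kd u) lt_uv neq_uv; case: (kd v).
Qed.

Variables (a b c d m : nat).
Hypothesis cardT2 : #|T| = m.+2.
Hypothesis kd_card : forall k, count_mem k (map kd (enum T)) = kind_card a b c d 1 k.
Hypotheses (b0 : 0 < b) (c0 : 0 < c).

Lemma mirror_card k :
  count_mem k (map (mirror \o kd) (enum T)) = kind_card d c b a 1 k.
Proof.
have -> : kind_card d c b a 1 k = kind_card a b c d 1 (mirror k) by case: k.
rewrite -kd_card !count_map; apply: eq_count => t /=; exact: mirror_eq.
Qed.

Lemma before_mirror L : before (mirror \o kd) KB KC L = before kd KC KB L.
Proof.
apply: eq_existsb => g /=; rewrite mirror_eq; congr (_ && _).
by apply: eq_forallb => h; rewrite mirror_eq.
Qed.

Lemma before_negb L : is_labeling L -> before kd KC KB L = ~~ before kd KB KC L.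
Proof.
move=> labL; have [g [h [fg fh]]] := first_B_C kd_card b0 c0 L.
rewrite (beforeE fg fh) (beforeE fh fg) -leqNgt [RHS]leq_eqVlt.
have /negPf -> // : L h != L g :> nat.
case/andP: fg => /eqP kg _; case/andP: fh => /eqP kh _.
by apply/eqP => /(labeling_inj labL) E; rewrite E kg in kh.
Qed.

(** Exchanging the labels of [x] and [z] turns the second family into the labelings
    with [L x = n], [L y = n-1] where the gammas come first. *)
Lemma count_before :
  count_labelings (fun L : {ffun T -> 'I_#|T|.+1} =>
    [&& L x == #|T| :> nat, L y == #|T|.-1 :> nat & before kd KB KC L]) +
  count_labelings (fun L : {ffun T -> 'I_#|T|.+1} =>
    [&& L z == #|T| :> nat, L y == #|T|.-1 :> nat & before (mirror \o kd) KB KC L]) = m`!.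
Proof.
have nxy : x != y by rewrite -(shape_y WT) (eqP (_ : kd x == KX)) // (shape_x WT).
pose sw (L : {ffun T -> 'I_#|T|.+1}) := [ffun t => L (tperm x z t)].
have swE L t : sw L t = L (tperm x z t) by rewrite ffunE.
have swK : involutive sw by move=> L; apply/ffunP => t; rewrite !swE tpermK.
have kdy : kd y = KY by apply/eqP; rewrite (shape_y WT).
have tx t : kd t \in [:: KB; KC; KY] -> tperm x z t = t.
  by move=> kt; rewrite tpermD //; apply: contraTneq kt => <-;
    [have := shape_x WT x | have := shape_z WT z]; rewrite eqxx => /eqP->.
rewrite [X in _ + X](_ : _ = count_labelings (fun L : {ffun T -> 'I_#|T|.+1} =>
    [&& L x == #|T| :> nat, L y == #|T|.-1 :> nat & ~~ before kd KB KC L])).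
  rewrite !count_labelings_sum -big_split /= -(card_labelings_last_two cardT2 nxy).
  rewrite -/(count_labelings _) count_labelings_sum; apply: eq_bigr => L _.
  by do 2!case: eqP => //= _; case: (before _ _ _ _).
rewrite /count_labelings -[RHS](card_imset _ (inv_inj swK)); apply: eq_card => L.
rewrite -[in RHS](swK L) (mem_imset _ _ (inv_inj swK)) !inE.
have -> : is_labeling (sw L) = is_labeling L.
  have labsw M : is_labeling M -> is_labeling (sw M).
    move=> labM; apply/labelingP; split=> [u v|t]; rewrite !swE.
      by move/(labeling_inj labM)/perm_inj.
    exact: labeling_gt0.
  by apply/idP/idP => [/labsw|/labsw//]; rewrite swK.
case: (boolP (is_labeling L)) => //= labL.
rewrite !swE tpermL (tx y) ?kdy //.
have -> : before kd KB KC (sw L) = before kd KB KC L.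
  apply: eq_existsb => g; case: eqP => //= kg; apply: eq_forallb => h.
  by case: eqP => //= kh; rewrite !swE !tx ?kg ?kh.
by rewrite before_mirror (before_negb labL).
Qed.

Lemma count_tangled :
  #|tangled_labelings T| +
  (a`! * b`! * c`! * d`! * size (blocked_words a b c d) +
   d`! * c`! * b`! * a`! * size (blocked_words d c b a)) =
  (a + b + c + d + 1) * m`!.
Proof.
have -> : #|tangled_labelings T| =
    count_labelings (fun L => (L x == #|T| :> nat) && tangled L) +
    count_labelings (fun L => (L z == #|T| :> nat) && tangled L).
  rewrite !count_labelings_sum -big_split /=.
  rewrite -[LHS]/(count_labelings tangled) count_labelings_sum.
  apply: eq_bigr => L labL; case: (boolP (tangled L)) => [tL|]; last by rewrite !andbF.
  have nxz : x != z.
    by rewrite -(shape_z WT) (eqP (_ : kd x == KX)) // (shape_x WT).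
  have neq_xz : (L x == #|T| :> nat) -> (L z == #|T| :> nat) = false.
    move=> /eqP Lx; apply: contraNF nxz => /eqP Lz.
    by apply/eqP/(labeling_inj labL); rewrite Lx Lz.
  have [Lx|Lz] := tangled_max_xz WT labL cardT2 tL.
    have Lx' : L x == #|T| :> nat by rewrite [in X in _ == X]cardT2; apply/eqP.
    by rewrite Lx' neq_xz.
  have Lz' : L z == #|T| :> nat by rewrite [in X in _ == X]cardT2; apply/eqP.
  by rewrite Lz'; case: eqP => // /eqP/neq_xz; rewrite Lz'.
have Ex := count_tangled_x WT cardT2 kd_card b0 c0.
have Ez := count_tangled_x W_shaped_mirror cardT2 mirror_card c0 b0.
rewrite addnACA Ex Ez addnACA count_before -mulnDl -[X in _ + X = _]mul1n -mulnDl.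
by rewrite (addnC d) !addnA.
Qed.

End Mirror.

(** * The W-poset *)

Section WShape.
Set Implicit Arguments.
Unset Strict Implicit.
Unset Printing Implicit Defensive.
Variables a b c d : nat.
Local Notation W := (W a b c d).
Implicit Types u v w : W.

Definition W_kind w : kind :=
  match w with
  | Alpha _ => KA | Beta _ => KB | Gamma _ => KC | Delta _ => KD
  | WX => KX | WY => KY | WZ => KZ
  end.

Lemma W_le_kind u v : W_le u v -> u = v \/ kind_lt (W_kind u) (W_kind v).
Proof.
case/connectP => p pth ->; elim: p u pth => [|w p IH] u /=; first by left.
case/andP => cuw /IH {IH}; set e := last w p => IH; right.
have : kind_lt (W_kind u) (W_kind w) by case: u w cuw {IH e} => [?|?|?|?|||] [?|?|?|?|||].
case: IH => [<-//|]; case: (W_kind u); case: (W_kind w) => //; by case: (W_kind e).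
Qed.

Lemma W_le_X_Alpha (i : 'I_a) : W_le WX (Alpha b c d i).
Proof.
case: i; elim=> [|k IH] ltk; first exact: connect1.
by apply: connect_trans (IH (ltnW ltk)) _; apply: connect1; rewrite /= eqxx.
Qed.

Lemma W_le_X_Beta (i : 'I_b) : W_le WX (Beta a c d i).
Proof.
case: i; elim=> [|k IH] ltk; first exact: connect1.
by apply: connect_trans (IH (ltnW ltk)) _; apply: connect1; rewrite /= eqxx.
Qed.

Lemma W_le_Z_Gamma (i : 'I_c) : W_le WZ (Gamma a b d i).
Proof.
case: i; elim=> [|k IH] ltk; first exact: connect1.
by apply: connect_trans (IH (ltnW ltk)) _; apply: connect1; rewrite /= eqxx.
Qed.

Lemma W_le_Z_Delta (i : 'I_d) : W_le WZ (Delta a b c i).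
Proof.
case: i; elim=> [|k IH] ltk; first exact: connect1.
by apply: connect_trans (IH (ltnW ltk)) _; apply: connect1; rewrite /= eqxx.
Qed.

Lemma W_le_Beta_Y (i : 'I_b) : W_le (Beta a c d i) WY.
Proof.
have [k] := ubnP (b - i); elim: k i => // k IH i lebi.
have := ltn_ord i; rewrite leq_eqVlt => /orP[/eqP eqi|lti].
  by apply: connect1; rewrite /= eqi.
apply: (@connect_trans _ _ (Beta a c d (Ordinal lti))).
  by apply: connect1; rewrite /= eqxx.
by apply: IH; rewrite /=; lia.
Qed.

Lemma W_le_Gamma_Y (i : 'I_c) : W_le (Gamma a b d i) WY.
Proof.
have [k] := ubnP (c - i); elim: k i => // k IH i lebi.
have := ltn_ord i; rewrite leq_eqVlt => /orP[/eqP eqi|lti].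
  by apply: connect1; rewrite /= eqi.
apply: (@connect_trans _ _ (Gamma a b d (Ordinal lti))).
  by apply: connect1; rewrite /= eqxx.
by apply: IH; rewrite /=; lia.
Qed.

Lemma W_shape (b0 : 0 < b) (c0 : 0 < c) : W_shaped W_kind (WX : W) WY WZ.
Proof.
have kd_eq u v : (u == v) -> W_kind u = W_kind v by move/eqP->.
split=> [t|t|t|u v|u v lt_uv neq_uv].
- by case: t => [i|i|i|i|||]; apply/esym; rewrite ?eqxx //; apply/negbTE/negP => /kd_eq.
- by case: t => [i|i|i|i|||]; apply/esym; rewrite ?eqxx //; apply/negbTE/negP => /kd_eq.
- by case: t => [i|i|i|i|||]; apply/esym; rewrite ?eqxx //; apply/negbTE/negP => /kd_eq.
- by rewrite lt_def => /andP[nvu /W_le_kind[Euv|//]]; rewrite Euv eqxx in nvu.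
rewrite lt_def; apply/andP; split.
  by apply: contraNneq neq_uv => ->.
apply: (_ : W_le u v).
case: u v lt_uv neq_uv => [i|i|i|i|||] [j|j|j|j|||] //= _ _.
- exact: W_le_Beta_Y.
- exact: W_le_Gamma_Y.
- exact: W_le_X_Alpha.
- exact: W_le_X_Beta.
- exact: W_le_trans (W_le_X_Beta (Ordinal b0)) (W_le_Beta_Y _).
- exact: W_le_Z_Gamma.
- exact: W_le_Z_Delta.
- exact: W_le_trans (W_le_Z_Gamma (Ordinal c0)) (W_le_Gamma_Y _).
Qed.

Definition W_block k : seq W :=
  match k with
  | KA => [seq Alpha b c d i | i <- enum 'I_a]
  | KB => [seq Beta a c d i | i <- enum 'I_b]
  | KC => [seq Gamma a b d i | i <- enum 'I_c]
  | KD => [seq Delta a b c i | i <- enum 'I_d]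
  | KX => [:: WX] | KY => [:: WY] | KZ => [:: WZ]
  end.

Definition kinds := [:: KA; KB; KC; KD; KX; KY; KZ].

Lemma W_blockP k w : (w \in W_block k) = (W_kind w == k).
Proof.
apply/idP/eqP => [|<-].
  by case: k => /= [/mapP[i _ ->]|/mapP[i _ ->]|/mapP[i _ ->]|/mapP[i _ ->]|||];
     rewrite ?inE // => /eqP->.
by case: w => [i|i|i|i|||]; rewrite /= ?map_f ?mem_enum ?inE.
Qed.

Lemma perm_enum_W : perm_eq (enum {: W}) (flatten [seq W_block k | k <- kinds]).
Proof.
apply: uniq_perm => [||t]; first exact: enum_uniq.
  apply: (uniq_flatten_map (key := W_kind) (tag := id)) => //.
    by case=> _ //; rewrite [W_block _]/= map_inj_uniq => [|i j []//]; apply: enum_uniq.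
  by move=> k w _; rewrite W_blockP => /eqP.
rewrite mem_enum; apply/esym/flatten_mapP; exists (W_kind t).
  by case: (W_kind t).
by rewrite W_blockP.
Qed.

Lemma size_W_block k : size (W_block k) = kind_card a b c d 1 k.
Proof. by case: k => //; rewrite [W_block _]/= size_map size_enum_ord. Qed.

Lemma W_kind_card k : count_mem k (map W_kind (enum {: W})) = kind_card a b c d 1 k.
Proof.
have := seq.permP (perm_map W_kind perm_enum_W) (pred1 k) => ->.
rewrite count_map count_flatten_map (bigD1_seq k) //=; last by case: k.
rewrite (eq_in_count (a2 := predT)) => [|w]; last by rewrite W_blockP.
rewrite count_predT size_W_block big1 ?addn0 // => k' nk.
rewrite (eq_in_count (a2 := pred0)) ?count_pred0 // => w.
by rewrite W_blockP /= => /eqP->; apply/negbTE.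
Qed.

Lemma card_W : #|{: W}| = (a + b + c + d + 1).+2.
Proof.
rewrite cardT (perm_size perm_enum_W) size_flatten_map.
by rewrite !big_cons big_nil !size_W_block /=; lia.
Qed.

End WShape.

Theorem theorem4p7 (a b c d : nat)
    (ha : 0 < a) (hb : 0 < b) (hc : 0 < c) (hd : 0 < d) :
  let n := a + b + c + d + 3 in
  let X := 'C(n - 2, a) *
    \sum_(0 <= i < b) \sum_(0 <= j < d.+1) (d - j + 1) * trinomial i j (c - 1) in
  let Z := 'C(n - 2, d) *
    \sum_(0 <= i < c) \sum_(0 <= j < a.+1) (a - j + 1) * trinomial i j (b - 1) in
  (#|tangled_labelings (W a b c d)|%:Z =
    ((n - 2) * (n - 2)`!)%:Z - (a`! * b`! * c`! * d`! * (X + Z))%:Z)%R.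
Proof.
move=> n X Z.
have n2 : n - 2 = a + b + c + d + 1 by rewrite /n; lia.
have := count_tangled (W_shape a d hb hc) (card_W a b c d) (@W_kind_card a b c d) hb hc.
rewrite !size_blocked_words // -n2.
have -> : d + c + b + a + 1 = n - 2 by rewrite n2; lia.
have -> : d`! * c`! * b`! * a`! = a`! * b`! * c`! * d`!.
  by clear; lia.
rewrite -/X -/Z -mulnDr => <-.
by rewrite PoszD addrK.
Qed.
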